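(* Let $R$ be a ring with identity, let $(I,\le)$ be a partially ordered set, and let $\Gamma=(A,V,s,t)$ be a directed graph which is locally filtered covered by graphs $\Gamma_i=(A_i,V_i,s_i,t_i)$, $i\in I$. Let $E\subseteq V$ be a subset such that $E=\bigcup_{i\in I}E_i$ is a locally filtered covering by subsets $E_i\subseteq V_i$. Then for each $R$-representation $F$ of $\Gamma$, with $F_i=F|_{\Gamma_i}$, there exists an exact sequence of $R$-modules $$0\to \operatorname{colim}_2^I\{\Phi_0(\Gamma_i,E_i;F_i)\}\to \operatorname{colim}^I\{\Phi(\Gamma_i,E_i;F_i)\}\to \Phi(\Gamma,E;F)\to \operatorname{colim}_1^I\{\Phi_0(\Gamma_i,E_i;F_i)\}\to 0 .$$
   Context: $\mathrm{Mod}_R$ is the category of left $R$-modules. For a small category $\mathbf C$, $\operatorname{colim}_n^{\mathbf C}:\mathrm{Mod}_R^{\mathbf C}\to \mathrm{Mod}_R$ denotes the $n$-th left derived functor of the colimit functor $\operatorname{colim}^{\mathbf C}$. The poset $I$ is regarded as a category with one morphism $i\to j$ whenever $i\le j$. A (directed) graph $\Gamma=(A,V,s,t)$ consists of a set $A$ of arrows, a set $V$ of vertices and two functions $s,t:A\to V$ (source and target); no finiteness is assumed. An $R$-representation $F$ of $\Gamma$ is a family of left $R$-modules $\{F(v)\}_{v\in V}$ together with $R$-homomorphisms $F(\alpha):F(s(\alpha))\to F(t(\alpha))$ for $\alpha\in A$. $W\Gamma$ is the category of paths in $\Gamma$ (the free category on $\Gamma$), and $\widetilde F:W\Gamma\to\mathrm{Mod}_R$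 is the unique functor extending $F$. Locally filtered coverings: a covering $X=\bigcup_{i\in I}X_i$ of a set $X$ by subsets indexed by $I$ is locally filtered if $i<j$ in $I$ implies $X_i\subseteq X_j$, and for all $i,j\in I$ and each $x\in X_i\cap X_j$ there exists $k\in I$ with $k\le i$, $k\le j$ and $x\in X_k\subseteq X_i\cap X_j$. The graph $\Gamma$ is locally filtered covered by the graphs $\Gamma_i=(A_i,V_i,s_i,t_i)$ if $A=\bigcup_i A_i$ and $V=\bigcup_i V_i$ are locally filtered coverings and the source and target maps are compatible with the inclusions: each $\Gamma_i$ is a subgraph of $\Gamma$ (so $s_i=s|_{A_i}$, $t_i=t|_{A_i}$ take values in $V_i$), and for $i\le j$ the inclusions $A_i\subseteq A_j$, $V_i\subseteq V_j$ commute with $s_i,s_j$ and with $t_i,t_j$. For a graph $\Gamma=(A,V,s,t)$, subset $E\subseteq V$ and $R$-representation $F$, let $d:\bigoplus_{\gamma\in A}F(s(\gamma))\to\bigoplus_{v\in V}F(v)$ be given by $d(f)_v=\sum_{t(\gamma)=v}F(\gamma)(f_\gamma)-\sum_{s(\gamma)=v}f_\gamma$. Then $$\Phi(\Gamma,E;F)=\{f\in\textstyle\bigoplus_{\gamma\in A}F(s(\gamma)) : d(f)_v=0\ \text{for all } v\in V\setminus E\}.$$ Let $\Gamma\cup_E pt$ be the graph obtained from $\Gamma$ by adding one new vertex $*$ and, for each $e\in E$, one new arrow $\gamma_e$ with $s(\gamma_e)=e$, $t(\gamma_e)=*$, and let $F\oplus_E0$ be the $R$-representation of $\Gamma\cup_E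 pt$ restricting to $F$ on $\Gamma$ and with value $0$ at $*$. Then $$\Phi_0(\Gamma,E;F)=\operatorname{colim}^{W(\Gamma\cup_E pt)}\widetilde{(F\oplus_E 0)}$$ (for $E=\emptyset$ this is $\operatorname{colim}^{W\Gamma}\widetilde F$). The assignments $i\mapsto\Phi_0(\Gamma_i,E_i;F_i)$ and $i\mapsto\Phi(\Gamma_i,E_i;F_i)$ are functors $I\to\mathrm{Mod}_R$: for $i\le j$ the maps are induced by the inclusions $\Gamma_i\cup_{E_i}pt\subseteq\Gamma_j\cup_{E_j}pt$ (on $\Phi$: extension of $1$-chains by zero). *)

(* Defs.v *)
From HB Require Import structures.
From mathcomp Require Import all_boot all_order all_algebra generic_quotient.
From mathcomp Require Import finmap.
From mathcomp Require Import boolp classical_sets functions cardinality fsbigop.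

Set Implicit Arguments.
Unset Strict Implicit.
Unset Printing Implicit Defensive.

Import Order.TTheory GRing.Theory.

Local Open Scope quotient_scope.
Local Open Scope classical_set_scope.
Local Open Scope ring_scope.

Record submod (R : pzRingType) (M : lmodType R) := Submod {
  sm_set :> M -> Prop;
  sm0 : sm_set 0;
  smP : forall a x y, sm_set x -> sm_set y -> sm_set (a *: x + y) }.

Section SubModule.
Variables (R : pzRingType) (M : lmodType R) (S : submod M).

Definition sm_pred : {pred M} := [pred x | `[< S x >]].

Fact sm_pred_closed : submod_closed sm_pred.
Proof.
split=> [|a x y]; first by apply/asboolP; exact: sm0.
by move=> /asboolP Sx /asboolP Sy; apply/asboolP; exact: smP.
Qed.

HB.instance Definition _ := GRing.isSubmodClosed.Build R M sm_pred sm_pred_closed.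

Record subm := Subm { sm_val : M; sm_valP : sm_val \in sm_pred }.

HB.instance Definition _ := [isSub for sm_val].
HB.instance Definition _ := [Choice of subm by <:].
HB.instance Definition _ := [SubChoice_isSubLmodule of subm by <:].

Lemma sm_valS (x : subm) : S (val x).
Proof. exact/asboolP/(valP x). Qed.

Definition sm_mk x (Sx : S x) : subm := @Subm x (asboolT Sx).

End SubModule.

Section SubModuleMap.
Variables (R : pzRingType) (M N : lmodType R) (S : submod M) (T : submod N).
Variables (f : {linear M -> N}) (fST : forall x, S x -> T (f x)).

Definition subm_map_fun (x : subm S) : subm T := sm_mk (fST (sm_valS x)).

Fact subm_map_is_linear : linear subm_map_fun.
Proof. by move=> a x y; apply: val_inj; rewrite /= !linearP. Qed.

HB.instance Definition _ := GRing.isLinear.Build R (subm S) (subm T) _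
  subm_map_fun subm_map_is_linear.

Definition subm_map : {linear subm S -> subm T} := subm_map_fun.

End SubModuleMap.

Section Kernel.
Variables (R : pzRingType) (M N : lmodType R) (f : {linear M -> N}).

Fact ker_submod_closed a x y : f x = 0 -> f y = 0 -> f (a *: x + y) = 0.
Proof. by move=> fx fy; rewrite linearP fx fy scaler0 addr0. Qed.

Definition ker_submod : submod M :=
  @Submod R M (fun x => f x = 0) (linear0 f) ker_submod_closed.

End Kernel.

Section Quotient.
Variables (R : pzRingType) (M : lmodType R) (S : submod M).

Definition quot_rel : rel M := fun x y => `[< S (x - y) >].

Lemma smN x : S x -> S (- x).
Proof.
by move=> Sx; have := smP (-1) Sx (sm0 S); rewrite addr0 scaleN1r.
Qed.

Lemma smD x y : S x -> S y -> S (x + y).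
Proof. by move=> Sx Sy; have := smP 1 Sx Sy; rewrite scale1r. Qed.

Lemma smZ a x : S x -> S (a *: x).
Proof. by move=> Sx; have := smP a Sx (sm0 S); rewrite addr0. Qed.

Fact quot_rel_equiv : equiv_class_of quot_rel.
Proof.
split=> [x|x y|y x z]; rewrite /quot_rel.
- by apply/asboolP; rewrite subrr; exact: sm0.
- by apply/asboolP/asboolP => /smN; rewrite opprB.
- by move=> /asboolP xy /asboolP yz; apply/asboolP; have := smD xy yz;
    rewrite addrA subrK.
Qed.

Canonical quot_equiv := EquivRelPack quot_rel_equiv.

Definition quotm : Type := {eq_quot quot_equiv}.
HB.instance Definition _ := Choice.on quotm.
HB.instance Definition _ := Quotient.on quotm.

Definition qpi_fun (x : M) : quotm := \pi_quotm x.

Lemma qpi_eq x y : qpi_fun x = qpi_fun y <-> S (x - y).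
Proof.
rewrite /qpi_fun; split=> [/eqmodP|h]; first by move/asboolP.
by apply/eqmodP/asboolP.
Qed.

Definition qrepr (x : quotm) : M := repr x.

Lemma qreprK x : qpi_fun (qrepr x) = x.
Proof. exact: reprK. Qed.

Lemma qrepr_pi x : S (qrepr (qpi_fun x) - x).
Proof. by apply/qpi_eq; rewrite qreprK. Qed.

Definition qadd x y := qpi_fun (qrepr x + qrepr y).
Definition qopp x := qpi_fun (- qrepr x).
Definition qscale a x := qpi_fun (a *: qrepr x).

Lemma qaddE x y : qadd (qpi_fun x) (qpi_fun y) = qpi_fun (x + y).
Proof.
by apply/qpi_eq; rewrite opprD addrACA; apply: smD; exact: qrepr_pi.
Qed.

Lemma qoppE x : qopp (qpi_fun x) = qpi_fun (- x).
Proof. by apply/qpi_eq; rewrite -opprD; apply: smN; exact: qrepr_pi. Qed.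

Lemma qscaleE a x : qscale a (qpi_fun x) = qpi_fun (a *: x).
Proof. by apply/qpi_eq; rewrite -scalerBr; apply: smZ; exact: qrepr_pi. Qed.

Fact qaddA : associative qadd.
Proof.
move=> x y z; rewrite -(qreprK x) -(qreprK y) -(qreprK z).
by rewrite !qaddE addrA.
Qed.

Fact qaddC : commutative qadd.
Proof. by move=> x y; rewrite -(qreprK x) -(qreprK y) !qaddE addrC. Qed.

Fact qadd0 : left_id (qpi_fun 0) qadd.
Proof. by move=> x; rewrite -(qreprK x) qaddE add0r. Qed.

Fact qaddN : left_inverse (qpi_fun 0) qopp qadd.
Proof. by move=> x; rewrite -(qreprK x) qoppE qaddE addNr. Qed.

HB.instance Definition _ := GRing.isZmodule.Build quotm qaddA qaddC qadd0 qaddN.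

Fact qscaleA a b x : qscale a (qscale b x) = qscale (a * b) x.
Proof. by rewrite -(qreprK x) !qscaleE scalerA. Qed.

Fact qscale1 : left_id 1 qscale.
Proof. by move=> x; rewrite -(qreprK x) qscaleE scale1r. Qed.

Fact qscaleDr : right_distributive qscale +%R.
Proof.
move=> a x y; rewrite -(qreprK x) -(qreprK y).
have -> : qpi_fun (qrepr x) + qpi_fun (qrepr y) = qpi_fun (qrepr x + qrepr y)
  by exact: qaddE.
rewrite !qscaleE scalerDr; symmetry; exact: qaddE.
Qed.

Fact qscaleDl x : {morph qscale^~ x : a b / a + b}.
Proof.
move=> a b; rewrite -(qreprK x) !qscaleE scalerDl; symmetry; exact: qaddE.
Qed.

HB.instance Definition _ := GRing.Zmodule_isLmodule.Build R quotm
  qscaleA qscale1 qscaleDr qscaleDl.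

Fact qpi_is_linear : linear qpi_fun.
Proof.
move=> a x y.
have -> : a *: qpi_fun x = qpi_fun (a *: x) by exact: qscaleE.
symmetry; exact: qaddE.
Qed.

HB.instance Definition _ := GRing.isLinear.Build R M quotm _
  qpi_fun qpi_is_linear.

Definition qpi : {linear M -> quotm} := qpi_fun.

Lemma qpi_eq0 x : qpi x = 0 <-> S x.
Proof.
have -> : (0 : quotm) = qpi 0 by rewrite linear0.
by rewrite qpi_eq subr0.
Qed.

Lemma qpi_surj y : exists x, qpi x = y.
Proof. by exists (qrepr y); exact: qreprK. Qed.

End Quotient.

Section QuotientDesc.
Variables (R : pzRingType) (M N : lmodType R) (S : submod M).
Variables (f : {linear M -> N}) (fS : forall x, S x -> f x = 0).

Definition quot_desc_fun (x : quotm S) : N := f (qrepr x).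

Lemma quot_desc_funE x : quot_desc_fun (qpi S x) = f x.
Proof.
apply/eqP; rewrite -subr_eq0 -linearB; apply/eqP/fS.
exact: qrepr_pi.
Qed.

Fact quot_desc_is_linear : linear quot_desc_fun.
Proof.
move=> a x y; have [x' <-] := qpi_surj x; have [y' <-] := qpi_surj y.
by rewrite -linearP !quot_desc_funE linearP.
Qed.

HB.instance Definition _ := GRing.isLinear.Build R (quotm S) N _
  quot_desc_fun quot_desc_is_linear.

Definition quot_desc : {linear quotm S -> N} := quot_desc_fun.

Lemma quot_descE x : quot_desc (qpi S x) = f x.
Proof. exact: quot_desc_funE. Qed.

End QuotientDesc.

Section Product.
Variables (R : pzRingType) (I : Type) (M : I -> lmodType R).

Definition dprod : Type := forall i, M i.

HB.instance Definition _ := gen_eqMixin dprod.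
HB.instance Definition _ := gen_choiceMixin dprod.

Let dpadd (f g : dprod) : dprod := fun i => f i + g i.
Let dpopp (f : dprod) : dprod := fun i => - f i.
Let dp0 : dprod := fun i => 0.
Let dpscale a (f : dprod) : dprod := fun i => a *: f i.

Fact dpaddA : associative dpadd.
Proof. by move=> f g h; apply: functional_extensionality_dep => i; exact: addrA. Qed.
Fact dpaddC : commutative dpadd.
Proof. by move=> f g; apply: functional_extensionality_dep => i; exact: addrC. Qed.
Fact dpadd0 : left_id dp0 dpadd.
Proof. by move=> f; apply: functional_extensionality_dep => i; exact: add0r. Qed.
Fact dpaddN : left_inverse dp0 dpopp dpadd.
Proof. by move=> f; apply: functional_extensionality_dep => i; exact: addNr. Qed.

HB.instance Definition _ := GRing.isZmodule.Build dprod dpaddA dpaddC dpadd0 dpaddN.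

Fact dpscaleA a b f : dpscale a (dpscale b f) = dpscale (a * b) f.
Proof. by apply: functional_extensionality_dep => i; exact: scalerA. Qed.
Fact dpscale1 : left_id 1 dpscale.
Proof. by move=> f; apply: functional_extensionality_dep => i; exact: scale1r. Qed.
Fact dpscaleDr : right_distributive dpscale +%R.
Proof. by move=> a f g; apply: functional_extensionality_dep => i; exact: scalerDr. Qed.
Fact dpscaleDl f : {morph dpscale^~ f : a b / a + b}.
Proof. by move=> a b; apply: functional_extensionality_dep => i; exact: scalerDl. Qed.

HB.instance Definition _ := GRing.Zmodule_isLmodule.Build R dprod
  dpscaleA dpscale1 dpscaleDr dpscaleDl.

End Product.

Section DirectSum.
Variables (R : pzRingType) (I : Type) (M : I -> lmodType R).

Definition dsupp (f : dprod M) : set {classic I} := [set i | f i <> 0].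

Fact dsum_closed0 : finite_set (dsupp 0).
Proof.
rewrite (_ : dsupp 0 = set0); first exact: finite_set0.
by apply/seteqP; split=> i //=.
Qed.

Fact dsum_closedP a (f g : dprod M) :
  finite_set (dsupp f) -> finite_set (dsupp g) -> finite_set (dsupp (a *: f + g)).
Proof.
move=> ff fg; apply: (@sub_finite_set _ _ (dsupp f `|` dsupp g)); last first.
  by rewrite finite_setU.
move=> i; rewrite /dsupp /= => h; apply: contrapT => /not_orP[/contrapT fi /contrapT gi].
by apply: h; rewrite -[LHS]/(a *: f i + g i) fi gi scaler0 addr0.
Qed.

Definition dsum_submod : submod (dprod M) :=
  @Submod R (dprod M) (fun f => finite_set (dsupp f)) dsum_closed0 dsum_closedP.

Definition dsum : Type := subm dsum_submod.
HB.instance Definition _ := GRing.Lmodule.on dsum.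

Definition dsum_fun (f : dsum) : dprod M := sm_val f.
Definition dcoord (f : dsum) (i : I) : M i := dsum_fun f i.

Arguments dcoord : simpl never.

Lemma dsum_finite (f : dsum) : finite_set (dsupp (dcoord f)).
Proof. exact: (sm_valS f). Qed.

Lemma dsumP (f g : dsum) : (forall i, dcoord f i = dcoord g i) -> f = g.
Proof. by move=> fg; apply: val_inj; apply: functional_extensionality_dep. Qed.

Lemma dcoordD f g i : dcoord (f + g) i = dcoord f i + dcoord g i. Proof. by []. Qed.
Lemma dcoordZ a f i : dcoord (a *: f) i = a *: dcoord f i. Proof. by []. Qed.
Lemma dcoordN f i : dcoord (- f) i = - dcoord f i. Proof. by []. Qed.
Lemma dcoord0 i : dcoord 0 i = 0. Proof. by []. Qed.

Lemma dcoord_sum (J : Type) (s : seq J) (f : J -> dsum) i :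
  dcoord (\sum_(j <- s) f j) i = \sum_(j <- s) dcoord (f j) i.
Proof. by elim/big_rec2: _ => // j x y _ <-. Qed.

(* the family with x at i and 0 elsewhere *)
Definition single_fun i (x : M i) : dprod M := fun j =>
  if pselect (i = j) is left e then eq_rect i M x j e else 0.

Fact single_finite i x : finite_set (dsupp (@single_fun i x)).
Proof.
apply: (@sub_finite_set _ _ [set i]); last exact: finite_set1.
move=> j; rewrite /dsupp /single_fun /=.
by case: pselect => // e _; rewrite e.
Qed.

Definition dinj_fun i (x : M i) : dsum := @sm_mk _ _ dsum_submod _ (single_finite x).

Lemma dcoord_dinj i (x : M i) : dcoord (dinj_fun x) i = x.
Proof.
rewrite /dcoord /= /single_fun; case: pselect => // e.
by rewrite (Prop_irrelevance e erefl).
Qed.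

Lemma dcoord_dinj_neq i (x : M i) j : i <> j -> dcoord (dinj_fun x) j = 0.
Proof. by rewrite /dcoord /= /single_fun; case: pselect. Qed.

Fact dinj_is_linear i : linear (@dinj_fun i).
Proof.
move=> a x y; apply: dsumP => j; rewrite dcoordD dcoordZ.
have [e|ne] := pselect (i = j); first by subst j; rewrite !dcoord_dinj.
by rewrite !dcoord_dinj_neq// scaler0 addr0.
Qed.

HB.instance Definition _ i := GRing.isLinear.Build R (M i) dsum _
  (@dinj_fun i) (@dinj_is_linear i).

Definition dinj i : {linear M i -> dsum} := @dinj_fun i.

Section Desc.
Variables (N : lmodType R) (g : forall i, {linear M i -> N}).

Definition dsum_desc_fun (f : dsum) : N :=
  \sum_(i \in [set: {classic I}]) g i (dcoord f i).

Lemma dsum_desc_funE (X : {fset {classic I}}) (f : dsum) :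
  (forall i : {classic I}, i \notin X -> dcoord f i = 0) ->
  dsum_desc_fun f = \sum_(i <- X) g i (dcoord f i).
Proof. by move=> fX; apply: fsbigTE => i /fX ->; rewrite linear0. Qed.

Lemma dsum_fset (f : dsum) : exists X : {fset {classic I}},
  forall i : {classic I}, i \notin X -> dcoord f i = 0.
Proof.
have /finite_fsetP[X fX] := dsum_finite f; exists X => i iX.
apply: contrapT => fi; have : dsupp (dcoord f) i by [].
by rewrite fX /= => h; rewrite h in iX.
Qed.

Fact dsum_desc_is_linear : linear dsum_desc_fun.
Proof.
move=> a f h; have [X fX] := dsum_fset f; have [Y hY] := dsum_fset h.
have fXY (i : {classic I}) : i \notin (X `|` Y)%fset -> dcoord f i = 0.
  by rewrite in_fsetU negb_or => /andP[/fX].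
have hXY (i : {classic I}) : i \notin (X `|` Y)%fset -> dcoord h i = 0.
  by rewrite in_fsetU negb_or => /andP[_ /hY].
rewrite (dsum_desc_funE fXY) (dsum_desc_funE hXY) (@dsum_desc_funE (X `|` Y)%fset).
  rewrite scaler_sumr -big_split /=; apply: eq_bigr => i _.
  by rewrite dcoordD dcoordZ linearP.
by move=> i iXY; rewrite dcoordD dcoordZ fXY// hXY// scaler0 addr0.
Qed.

HB.instance Definition _ := GRing.isLinear.Build R dsum N _
  dsum_desc_fun dsum_desc_is_linear.

Definition dsum_desc : {linear dsum -> N} := dsum_desc_fun.

Lemma dsum_desc_dinj i (x : M i) : dsum_desc (dinj i x) = g i x.
Proof.
rewrite /dsum_desc /= (@dsum_desc_funE [fset (i : {classic I})]%fset).
  by rewrite big_seq_fset1 dcoord_dinj.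
by move=> j; rewrite in_fset1 => /eqP ij; rewrite dcoord_dinj_neq// => e; exact: ij.
Qed.

End Desc.

Lemma dsum_decomp (f : dsum) (X : {fset {classic I}}) :
  (forall i : {classic I}, i \notin X -> dcoord f i = 0) ->
  f = \sum_(i <- X) dinj i (dcoord f i).
Proof.
move=> fX; apply: dsumP => j; rewrite dcoord_sum.
have [jX|jX] := boolP ((j : {classic I}) \in X); last first.
  rewrite fX// big1_fset// => i iX _; rewrite dcoord_dinj_neq// => e.
  by move: iX jX; rewrite e => ->.
rewrite (big_fsetD1 (j : {classic I}))//= dcoord_dinj big1_fset ?addr0// => i.
by rewrite in_fsetD1 => /andP[/eqP ij _] _; rewrite dcoord_dinj_neq.
Qed.

Lemma dsum_ext (N : lmodType R) (f g : {linear dsum -> N}) :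
  (forall i x, f (dinj i x) = g (dinj i x)) -> forall x, f x = g x.
Proof.
move=> fg x; have [X xX] := dsum_fset x.
by rewrite (dsum_decomp xX) !linear_sum; apply: eq_bigr => i _.
Qed.

End DirectSum.

Arguments dcoord {R I M} f i.

(* push-forward of finitely supported families along p *)
Definition dsum_map (R : pzRingType) (I J : Type) (M : I -> lmodType R)
    (N : J -> lmodType R) (p : I -> J) (g : forall i, {linear M i -> N (p i)}) :
    {linear dsum M -> dsum N} :=
  dsum_desc (fun i => (dinj N (p i) \o g i : {linear M i -> dsum N})).

Section Image.
Variables (R : pzRingType) (M N : lmodType R) (f : {linear M -> N}).

Fact im_submod0 : exists x, f x = 0.
Proof. by exists 0; exact: linear0. Qed.

Fact im_submodP a x y :
  (exists u, f u = x) -> (exists u, f u = y) -> exists u, f u = a *: x + y.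
Proof. by move=> [u <-] [v <-]; exists (a *: u + v); exact: linearP. Qed.

Definition im_submod : submod N :=
  @Submod R N (fun y => exists x, f x = y) im_submod0 im_submodP.

End Image.

Definition exact_at (R : pzRingType) (A B C : lmodType R)
    (f : {linear A -> B}) (g : {linear B -> C}) : Prop :=
  forall y, g y = 0 <-> exists x, f x = y.

Definition surj (T U : Type) (f : T -> U) : Prop := forall y, exists x, f x = y.

Record category := Category {
  Ob : Type;
  Hom : Ob -> Ob -> Type;
  idm : forall a, Hom a a;
  compm : forall a b c, Hom b c -> Hom a b -> Hom a c;
  compm_idl : forall a b (f : Hom a b), compm (idm b) f = f;
  compm_idr : forall a b (f : Hom a b), compm f (idm a) = f;
  compmA : forall a b c d (f : Hom a b) (g : Hom b c) (h : Hom c d),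
    compm h (compm g f) = compm (compm h g) f }.

Record functor (R : pzRingType) (C : category) := Functor {
  fobj :> Ob C -> lmodType R;
  fmap : forall a b, Hom a b -> {linear fobj a -> fobj b};
  fmap_id : forall a x, fmap (idm a) x = x;
  fmap_comp : forall a b c (g : Hom b c) (f : Hom a b) x,
    fmap (compm g f) x = fmap g (fmap f x) }.

Arguments fmap {R C} _ {a b} _.

Record nattrans (R : pzRingType) (C : category) (F G : functor R C) := NatTrans {
  ntcomp :> forall c, {linear F c -> G c};
  nt_natural : forall a b (f : Hom a b) x,
    ntcomp b (fmap F f x) = fmap G f (ntcomp a x) }.

Section Colimit.
Variables (R : pzRingType) (C : category) (F : functor R C).

Definition arrow := {a : Ob C & {b : Ob C & Hom a b}}.
Definition adom (m : arrow) : Ob C := projT1 m.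
Definition acod (m : arrow) : Ob C := projT1 (projT2 m).
Definition ahom (m : arrow) : Hom (adom m) (acod m) := projT2 (projT2 m).

(* colim F is the cokernel of the usual map from the sum over all arrows
   f : a -> b of F a to the sum over all objects, x |-> F f x - x *)
Definition colim_rel : {linear dsum (fun m => F (adom m)) -> dsum F} :=
  dsum_desc (fun m : arrow =>
    ((dinj F (acod m) \o fmap F (ahom m)) \- dinj F (adom m)
      : {linear F (adom m) -> dsum F})).

Definition colim : lmodType R := quotm (im_submod colim_rel).

Definition colim_inj c : {linear F c -> colim} := qpi (im_submod colim_rel) \o dinj F c.

Lemma colim_inj_nat a b (f : Hom a b) x :
  colim_inj b (fmap F f x) = colim_inj a x.
Proof.
apply/qpi_eq.
by exists (dinj (fun m => F (adom m)) (existT _ a (existT _ b f)) x); rewrite dsum_desc_dinj.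
Qed.

Lemma colim_ext (N : lmodType R) (f g : {linear colim -> N}) :
  (forall c x, f (colim_inj c x) = g (colim_inj c x)) -> forall x, f x = g x.
Proof.
move=> fg x; have [y <-] := qpi_surj x.
pose p := qpi (im_submod colim_rel).
by apply: (dsum_ext (f := f \o p : {linear dsum F -> N}) (g := g \o p : {linear dsum F -> N})).
Qed.

Section Desc.
Variables (N : lmodType R) (g : forall c, {linear F c -> N}).
Hypothesis g_cocone : forall a b (f : Hom a b) x, g b (fmap F f x) = g a x.

Fact colim_desc_subproof x : im_submod colim_rel x -> dsum_desc g x = 0.
Proof.
move=> [y <-].
apply: (dsum_ext (f := dsum_desc g \o colim_rel : {linear _ -> _}) (g := \0)) => m z /=.
by rewrite /colim_rel dsum_desc_dinj /= linearB /= !dsum_desc_dinj g_cocone subrr.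
Qed.

Definition colim_desc : {linear colim -> N} := quot_desc colim_desc_subproof.

Lemma colim_desc_inj c x : colim_desc (colim_inj c x) = g c x.
Proof.
exact: (etrans (quot_descE colim_desc_subproof (dinj F c x)) (dsum_desc_dinj g x)).
Qed.

End Desc.

End Colimit.

Arguments colim_inj {R C} F c.

Section ColimitMap.
Variables (R : pzRingType) (C : category) (F G : functor R C) (h : nattrans F G).

Fact colim_map_subproof a b (f : Hom a b) x :
  (colim_inj G b \o h b) (fmap F f x) = (colim_inj G a \o h a) x.
Proof. by rewrite /= nt_natural; exact: colim_inj_nat. Qed.

Definition colim_map : {linear colim F -> colim G} :=
  colim_desc (g := fun c => colim_inj G c \o h c : {linear F c -> colim G})
    colim_map_subproof.

End ColimitMap.

Definition projective (R : pzRingType) (C : category) (P : functor R C) : Prop :=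
  forall (F G : functor R C) (e : nattrans F G) (f : nattrans P G),
    (forall c, surj (e c)) ->
    exists g : nattrans P F, forall c x, e c (g c x) = f c x.

Record proj_resolution (R : pzRingType) (C : category) (F : functor R C) :=
  ProjResolution {
    res_obj : nat -> functor R C;
    res_d : forall n, nattrans (res_obj n.+1) (res_obj n);
    res_aug : nattrans (res_obj 0) F;
    res_projective : forall n, projective (res_obj n);
    res_aug_surj : forall c, surj (res_aug c);
    res_exact0 : forall c, exact_at (res_d 0 c) (res_aug c);
    res_exactS : forall n c, exact_at (res_d n.+1 c) (res_d n c) }.

Section Homology.
Variables (R : pzRingType) (M : nat -> lmodType R).
Variable (d : forall n, {linear M n.+1 -> M n}).

Definition chain_cycles n : submod (M n) :=
  match n return submod (M n) with
  | 0 => ker_submod (\0 : {linear M 0 -> M 0})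
  | n'.+1 => ker_submod (d n')
  end.

Definition chain_boundaries n : submod (subm (chain_cycles n)).
Proof.
apply: (@Submod R _ (fun x => im_submod (d n) (val x))); first exact: sm0.
by move=> a x y Sx Sy; rewrite linearP; apply: smP.
Defined.

Definition homology n : lmodType R := quotm (chain_boundaries n).

End Homology.

Section ScaleAt.
Variables (R : pzRingType) (M : lmodType R) (x : M).

Definition scale_at_fun (r : R^o) : M := (r : R) *: x.

Fact scale_at_is_linear : linear scale_at_fun.
Proof. by move=> a r s; rewrite /scale_at_fun scalerDl scalerA. Qed.

HB.instance Definition _ := GRing.isLinear.Build R R^o M _
  scale_at_fun scale_at_is_linear.

Definition scale_at : {linear R^o -> M} := scale_at_fun.

End ScaleAt.

(* The free functor on the underlying sets of F is
   d |-> the free module on the triples (c, f : c -> d, x in F c). *)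
Section FreeCover.
Variables (R : pzRingType) (C : category) (F : functor R C).

Definition fidx (d : Ob C) : Type := {c : Ob C & (Hom c d * F c)%type}.

Definition fidx_mk c d (f : Hom c d) (x : F c) : fidx d := existT _ c (f, x).

Definition fidx_push d e (g : Hom d e) (i : fidx d) : fidx e :=
  fidx_mk (compm g (projT2 i).1) (projT2 i).2.

Definition free_obj (d : Ob C) : lmodType R := dsum (fun _ : fidx d => R^o).

Definition fgen c d (f : Hom c d) (x : F c) : free_obj d :=
  dinj (fun _ : fidx d => R^o) (fidx_mk f x) 1.

Definition free_map d e (g : Hom d e) : {linear free_obj d -> free_obj e} :=
  dsum_map (N := fun _ : fidx e => R^o) (p := fidx_push g) (fun _ => (idfun : {linear R^o -> R^o})).

Lemma free_map_gen c d e (g : Hom d e) (f : Hom c d) (x : F c) :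
  free_map g (fgen f x) = fgen (compm g f) x.
Proof. by rewrite /free_map /dsum_map dsum_desc_dinj. Qed.

Lemma free_ext d (N : lmodType R) (f g : {linear free_obj d -> N}) :
  (forall c (h : Hom c d) x, f (fgen h x) = g (fgen h x)) -> forall x, f x = g x.
Proof.
move=> fg; apply: dsum_ext => -[c [h x]] r.
have -> : r = r *: (1 : R^o) by rewrite -[RHS]/(r * 1) mulr1.
by rewrite linearZ !linearZ_LR; congr (_ *: _); exact: fg.
Qed.

Fact free_map_id d x : free_map (idm d) x = x.
Proof.
apply: (free_ext (g := idfun : {linear _ -> _})) => c h y.
by rewrite free_map_gen compm_idl.
Qed.

Fact free_map_comp a b c (g : Hom b c) (f : Hom a b) x :
  free_map (compm g f) x = free_map g (free_map f x).
Proof.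
apply: (free_ext (g := free_map g \o free_map f : {linear _ -> _})) => d h y.
by rewrite /= !free_map_gen compmA.
Qed.

Definition free_functor : functor R C := Functor free_map_id free_map_comp.

Section Desc.
Variables (G : functor R C) (phi : forall c, F c -> G c).

Definition free_desc_comp d : {linear free_obj d -> G d} :=
  dsum_desc (fun i : fidx d => scale_at (fmap G (projT2 i).1 (phi (projT2 i).2))).

Lemma free_desc_gen c d (f : Hom c d) x :
  free_desc_comp d (fgen f x) = fmap G f (phi x).
Proof. by rewrite /free_desc_comp dsum_desc_dinj /= /scale_at_fun scale1r. Qed.

Fact free_desc_natural a b (f : Hom a b) x :
  free_desc_comp b (fmap free_functor f x) = fmap G f (free_desc_comp a x).
Proof.
apply: (free_ext (f := free_desc_comp b \o free_map f : {linear _ -> _})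
  (g := fmap G f \o free_desc_comp a : {linear _ -> _})) => c h y.
by rewrite /= free_map_gen !free_desc_gen fmap_comp.
Qed.

Definition free_desc : nattrans free_functor G := NatTrans free_desc_natural.

End Desc.

Definition free_cover : nattrans free_functor F := free_desc (fun c (x : F c) => x).

Lemma free_cover_surj c : surj (free_cover c).
Proof. by move=> y; exists (fgen (idm c) y); rewrite free_desc_gen fmap_id. Qed.

Lemma free_projective : projective free_functor.
Proof.
move=> G H e f es.
pose phi c (x : F c) : G c := sval (cid (es c (f c (fgen (idm c) x)))).
have phiE c (x : F c) : e c (phi c x) = f c (fgen (idm c) x).
  by rewrite /phi; case: cid.
exists (free_desc phi) => c.
apply: (free_ext (f := e c \o free_desc phi c : {linear _ -> _})) => d h x.
rewrite /= free_desc_gen nt_natural phiE -nt_natural /=.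
by rewrite free_map_gen compm_idr.
Qed.

End FreeCover.

Section KernelFunctor.
Variables (R : pzRingType) (C : category) (F G : functor R C) (e : nattrans F G).

Fact ker_map_subproof a b (f : Hom a b) x :
  ker_submod (e a) x -> ker_submod (e b) (fmap F f x).
Proof. by rewrite /= nt_natural => ->; rewrite linear0. Qed.

Definition ker_map a b (f : Hom a b) := subm_map (@ker_map_subproof a b f).

Fact ker_map_id a x : ker_map (idm a) x = x.
Proof. by apply: val_inj; exact: fmap_id. Qed.

Fact ker_map_comp a b c (g : Hom b c) (f : Hom a b) x :
  ker_map (compm g f) x = ker_map g (ker_map f x).
Proof. by apply: val_inj; exact: fmap_comp. Qed.

Definition ker_functor : functor R C := Functor ker_map_id ker_map_comp.

Definition ker_incl : nattrans ker_functor F :=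
  @NatTrans R C ker_functor F (fun c => (val : {linear subm (ker_submod (e c)) -> F c}))
    (fun a b f x => erefl).

End KernelFunctor.

Definition nt_comp (R : pzRingType) (C : category) (F G H : functor R C)
    (g : nattrans G H) (f : nattrans F G) : nattrans F H.
Proof.
refine (@NatTrans R C F H (fun c => g c \o f c : {linear F c -> H c}) _).
by move=> a b h x; rewrite /= !nt_natural.
Defined.

Section StandardResolution.
Variables (R : pzRingType) (C : category) (F : functor R C).

Fixpoint syzygy n : functor R C :=
  if n is n'.+1 then ker_functor (free_cover (syzygy n')) else F.

Definition std_obj n := free_functor (syzygy n).

Definition std_d n : nattrans (std_obj n.+1) (std_obj n) :=
  nt_comp (ker_incl (free_cover (syzygy n))) (free_cover (syzygy n.+1)).

Definition std_aug : nattrans (std_obj 0) F := free_cover F.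

Lemma std_exact n c : exact_at (std_d n c) (free_cover (syzygy n) c).
Proof.
move=> y; split=> [y0|[x <-]]; last exact: (sm_valS (free_cover (syzygy n.+1) c x)).
have [x xE] := free_cover_surj (@sm_mk _ _ (ker_submod (free_cover (syzygy n) c)) y y0 : syzygy n.+1 c).
by exists x; exact: (congr1 val xE).
Qed.

Lemma std_exactS n c : exact_at (std_d n.+1 c) (std_d n c).
Proof.
move=> y; rewrite -std_exact; split=> h; first exact: val_inj.
exact: (congr1 val h).
Qed.

(* colimn is computed on this resolution; projective resolutions being
   homotopy equivalent, the choice does not matter up to isomorphism *)
Definition std_resolution : proj_resolution F :=
  @ProjResolution R C F std_obj std_d std_aug (fun n => @free_projective R C (syzygy n))
    (@free_cover_surj R C F) (@std_exact 0) std_exactS.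

End StandardResolution.

Definition res_homology (R : pzRingType) (C : category) (F : functor R C)
    (P : proj_resolution F) (n : nat) : lmodType R :=
  homology (fun n => colim_map (res_d P n)) n.

(* The n-th left derived functor of colim : Mod_R^C -> Mod_R, on objects *)
Definition colimn (R : pzRingType) (C : category) (n : nat) (F : functor R C) :
    lmodType R :=
  res_homology (std_resolution F) n.

Definition poset_cat (d : Order.disp_t) (I : porderType d) : category :=
  @Category I (fun i j => (i <= j)%O : Prop) (fun i => lexx i)
    (fun i j k jk ij => le_trans ij jk)
    (fun i j f => Prop_irrelevance _ _) (fun i j f => Prop_irrelevance _ _)
    (fun i j k l f g h => Prop_irrelevance _ _).

Record graph := Graph {
  arr : Type;
  vert : Type;
  src : arr -> vert;
  tgt : arr -> vert }.

Section Paths.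
Variable G : graph.

(* a path is extended at its end: psnoc a p is p followed by a *)
Inductive gpath (u : vert G) : vert G -> Type :=
| pnil : gpath u u
| psnoc (a : arr G) : gpath u (src a) -> gpath u (tgt a).

Fixpoint pcat u v w (q : gpath v w) : gpath u v -> gpath u w :=
  match q in gpath _ w return gpath u v -> gpath u w with
  | pnil => fun p => p
  | psnoc a q' => fun p => psnoc (pcat q' p)
  end.

Fact pcat_nil u v (p : gpath u v) : pcat p (pnil u) = p.
Proof. by elim: p => //= a p ->. Qed.

Fact pcatA u v w x (p : gpath u v) (q : gpath v w) (r : gpath w x) :
  pcat r (pcat q p) = pcat (pcat r q) p.
Proof. by elim: r => //= a r ->. Qed.

Definition path_cat : category :=
  @Category (vert G) gpath pnil (fun u v w q p => pcat q p)
    (fun u v p => erefl) pcat_nil pcatA.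

End Paths.

Arguments pnil {G} u.
Arguments psnoc {G u} a _.

Record graph_rep (R : pzRingType) (G : graph) := GraphRep {
  rep_obj :> vert G -> lmodType R;
  rep_map : forall a, {linear rep_obj (src a) -> rep_obj (tgt a)} }.

Section PathFunctor.
Variables (R : pzRingType) (G : graph) (F : graph_rep R G).

Fixpoint path_map u v (p : gpath u v) : {linear F u -> F v} :=
  match p in gpath _ v return {linear F u -> F v} with
  | pnil => idfun
  | psnoc a p' => rep_map F a \o path_map p'
  end.

Fact path_map_comp u v w (q : gpath v w) (p : gpath u v) x :
  path_map (pcat q p) x = path_map q (path_map p x).
Proof. by elim: q => //= a q ->. Qed.

Definition path_functor : functor R (path_cat G) :=
  @Functor R (path_cat G) F path_map (fun _ _ => erefl) path_map_comp.

End PathFunctor.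

Section ZeroModule.
Variable R : pzRingType.

Definition zero_module : lmodType R := dsum (fun i : Empty_set => R^o).

Lemma zero_module0 (x : zero_module) : x = 0.
Proof. by apply: dsumP; case. Qed.

End ZeroModule.

(* G with a new vertex None and, for each e in E, a new arrow inr e from e to it *)
Definition cone_graph (G : graph) (E : set (vert G)) : graph :=
  {| arr := (arr G + E)%type;
     vert := option (vert G);
     src := fun a => match a with inl a => Some (src a) | inr e => Some (sval e) end;
     tgt := fun a => match a with inl a => Some (tgt a) | inr _ => None end |}.

Section ConeRep.
Variables (R : pzRingType) (G : graph) (E : set (vert G)) (F : graph_rep R G).

Definition cone_obj (v : vert (cone_graph E)) : lmodType R :=
  if v is Some v then F v else zero_module R.

Definition cone_map (a : arr (cone_graph E)) :
    {linear cone_obj (src a) -> cone_obj (tgt a)} :=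
  match a return {linear cone_obj (@src (cone_graph E) a) -> cone_obj (@tgt (cone_graph E) a)} with
  | inl a => rep_map F a
  | inr _ => \0
  end.

Definition cone_rep : graph_rep R (cone_graph E) := GraphRep cone_map.

Definition Phi0 : lmodType R := colim (path_functor cone_rep).

Definition Phi0_inj (v : vert (cone_graph E)) : {linear cone_rep v -> Phi0} :=
  colim_inj (path_functor cone_rep) v.

Lemma Phi0_arr (a : arr (cone_graph E)) x :
  Phi0_inj (tgt a) (rep_map cone_rep a x) = Phi0_inj (src a) x.
Proof. exact: (colim_inj_nat (F := path_functor cone_rep) (psnoc a (pnil _)) x). Qed.

End ConeRep.

Arguments Phi0_inj {R G} E F v.
Arguments Phi0_arr {R G E} F a x.

Section Phi.
Variables (R : pzRingType) (G : graph) (E : set (vert G)) (F : graph_rep R G).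

Definition chain1 : lmodType R := dsum (fun a : arr G => F (src a)).
Definition chain0 : lmodType R := dsum F.

(* f is sent to sum_a (F a (f a) placed at t a) - (f a placed at s a); the
   coordinatewise formula is bdE below *)
Definition bd : {linear chain1 -> chain0} :=
  dsum_desc (fun a =>
    ((dinj F (tgt a) \o rep_map F a) \- dinj F (src a)
      : {linear F (src a) -> dsum F})).

Fact Phi_submod0 v : ~ E v -> dcoord (bd 0) v = 0.
Proof. by rewrite linear0. Qed.

Fact Phi_submodP c (f g : chain1) :
  (forall v, ~ E v -> dcoord (bd f) v = 0) ->
  (forall v, ~ E v -> dcoord (bd g) v = 0) ->
  forall v, ~ E v -> dcoord (bd (c *: f + g)) v = 0.
Proof.
move=> hf hg v Ev; rewrite linearP dcoordD dcoordZ hf// hg//.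
by rewrite scaler0 addr0.
Qed.

Definition Phi_submod : submod chain1 :=
  @Submod R chain1 (fun f => forall v, ~ E v -> dcoord (bd f) v = 0)
    Phi_submod0 Phi_submodP.

Definition Phi : lmodType R := subm Phi_submod.

(* In each term below the index of dinj is equal to v, so that dcoord (dinj ..) v
   only transports its argument to F v: this is the usual
   d(f)_v = sum_(t a = v) F a (f a) - sum_(s a = v) f a *)
Lemma bdE (f : chain1) v :
  dcoord (bd f) v =
  \sum_(a \in [set a : {classic arr G} | tgt a = v])
     dcoord (dinj F (tgt a) (rep_map F a (dcoord f a))) v
  - \sum_(a \in [set a : {classic arr G} | src a = v])
     dcoord (dinj F (src a) (dcoord f a)) v.
Proof.
have [X fX] := dsum_fset f.
have key (q : arr G -> vert G) (h : forall a, {linear F (src a) -> F (q a)}) :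
    \sum_(a \in [set a : {classic arr G} | q a = v])
       dcoord (dinj F (q a) (h a (dcoord f a))) v
    = \sum_(a <- X) dcoord (dinj F (q a) (h a (dcoord f a))) v.
  rewrite fsbig_mkcond (@fsbigTE _ _ _ _ X) => [|a aX]; last first.
    rewrite /patch; case: ifP => // _; rewrite fX// linear0 linear0; exact: dcoord0.
  apply: eq_bigr => a _; rewrite /patch; case: ifPn => // /negP ha.
  by rewrite dcoord_dinj_neq// => e; apply: ha; rewrite inE.
rewrite (key _ (rep_map F)) (key _ (fun a => idfun)) /= /bd.
rewrite [X in dcoord X v](dsum_desc_funE _ fX) dcoord_sum -sumrB.
by apply: eq_bigr => a _; rewrite dcoordD dcoordN.
Qed.

End Phi.

Record subgraph (G : graph) := Subgraph {
  sarr : set (arr G);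
  svert : set (vert G);
  sub_src : forall a, sarr a -> svert (src a);
  sub_tgt : forall a, sarr a -> svert (tgt a) }.

Definition graph_of (G : graph) (H : subgraph G) : graph :=
  {| arr := sarr H;
     vert := svert H;
     src := fun a => exist _ (src (sval a)) (mem_set (sub_src (set_mem (svalP a))));
     tgt := fun a => exist _ (tgt (sval a)) (mem_set (sub_tgt (set_mem (svalP a)))) |}.

Definition rep_restr (R : pzRingType) (G : graph) (F : graph_rep R G)
    (H : subgraph G) : graph_rep R (graph_of H) :=
  @GraphRep R (graph_of H) (fun v => F (sval v)) (fun a => rep_map F (sval a)).

Definition set_restr (G : graph) (H : subgraph G) (E : set (vert G)) :
    set (vert (graph_of H)) := [set v | E (sval v)].

Arguments set_restr {G} H E.

Definition incl (T : Type) (A B : set T) (AB : A `<=` B) (x : A) : B :=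
  exist _ (sval x) (mem_set (AB _ (set_mem (svalP x)))).

Section Inclusion.
Variables (R : pzRingType) (G : graph) (F : graph_rep R G).
Variables (H K : subgraph G) (D E : set (vert G)).
Hypotheses (HKa : sarr H `<=` sarr K) (HKv : svert H `<=` svert K) (DE : D `<=` E).

Let FH := rep_restr F H.
Let FK := rep_restr F K.
Let DH := set_restr H D.
Let EK := set_restr K E.

Definition ext1 : {linear chain1 FH -> chain1 FK} :=
  dsum_map (N := fun a => FK (src a)) (p := incl HKa)
    (fun a => (idfun : {linear F (src (sval a)) -> F (src (sval a))})).

Definition ext0 : {linear chain0 FH -> chain0 FK} :=
  dsum_map (N := FK) (p := incl HKv)
    (fun v => (idfun : {linear F (sval v) -> F (sval v)})).

Lemma dinj_restr_irr v p q (x : F v) :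
  dinj FK (exist _ v p) x = dinj FK (exist _ v q) x.
Proof. by rewrite (Prop_irrelevance p q). Qed.

Lemma ext1_dinj (a : sarr H) (x : F (src (sval a))) :
  ext1 (dinj (fun a => FH (src a)) a x) = dinj (fun a => FK (src a)) (incl HKa a) x.
Proof. by rewrite /ext1 /dsum_map dsum_desc_dinj. Qed.

Lemma ext_bd f : bd FK (ext1 f) = ext0 (bd FH f).
Proof.
apply: (dsum_ext (f := bd FK \o ext1 : {linear _ -> _})
  (g := ext0 \o bd FH : {linear _ -> _})) => a x.
rewrite /= /ext1 /ext0 /dsum_map /bd !dsum_desc_dinj /= linearB /=.
rewrite [RHS](congr2 (fun u v => u - v) (dsum_desc_dinj _ _) (dsum_desc_dinj _ _)).
by congr (_ - _); exact: dinj_restr_irr.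
Qed.

Lemma ext0_coord (g : chain0 FH) (v : vert (graph_of K)) :
  (forall u, sval u = sval v -> dcoord g u = 0) -> dcoord (ext0 g) v = 0.
Proof.
move=> gv; have [X gX] := dsum_fset g.
rewrite /ext0 /dsum_map [X in dcoord X v](dsum_desc_funE _ gX) dcoord_sum big1// => u _.
have [e|ne] := pselect (sval u = sval v).
  rewrite gv//; exact: (congr1 (fun f => dcoord f v) (linear0 (dinj FK (incl HKv u)))).
by apply: dcoord_dinj_neq => e; apply: ne; rewrite -e.
Qed.

Fact Phi_map_subproof f : Phi_submod DH FH f -> Phi_submod EK FK (ext1 f).
Proof.
move=> hf v Ev; rewrite ext_bd; apply: ext0_coord => u uv.
by apply: hf => Du; apply: Ev; apply: DE; rewrite -uv.
Qed.

(* extension of chains by zero *)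
Definition Phi_map : {linear Phi DH FH -> Phi EK FK} := subm_map Phi_map_subproof.

Definition Phi0_comp (v : vert (cone_graph DH)) :
    {linear cone_rep DH FH v -> Phi0 EK FK} :=
  match v return {linear cone_rep DH FH v -> Phi0 EK FK} with
  | Some v => Phi0_inj EK FK (Some (incl HKv v))
  | None => Phi0_inj EK FK None
  end.

Lemma Phi0_inj_irr v p q (x : F v) :
  Phi0_inj EK FK (Some (exist _ v p)) x = Phi0_inj EK FK (Some (exist _ v q)) x.
Proof. by rewrite (Prop_irrelevance p q). Qed.

Fact Phi0_map_subproof u v (p : gpath u v) x :
  Phi0_comp v (path_map (cone_rep DH FH) p x) = Phi0_comp u x.
Proof.
elim: p => [|[a|e] p <-]; first by [].
  pose y : F (src (sval a)) := path_map (cone_rep DH FH) p x.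
  pose a' : arr (cone_graph EK) := inl (incl HKa a).
  have h1 : Phi0_comp (tgt (inl a : arr (cone_graph DH))) (rep_map F (sval a) y)
      = Phi0_inj EK FK (tgt a') (rep_map F (sval a) y) by exact: Phi0_inj_irr.
  have h2 : Phi0_inj EK FK (src a') y
      = Phi0_comp (src (inl a : arr (cone_graph DH))) y by exact: Phi0_inj_irr.
  exact: etrans h1 (etrans (Phi0_arr FK a' y) h2).
have EKe : sval (incl HKv (sval e)) \in E.
  by apply/mem_set/DE; exact: (set_mem (svalP e)).
pose e' : EK := exist _ (incl HKv (sval e)) (mem_set (set_mem EKe : EK _)).
exact: (Phi0_arr FK (inr e' : arr (cone_graph EK)) (path_map (cone_rep DH FH) p x)).
Qed.

(* induced by the inclusion of the cone graph of H into that of K *)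
Definition Phi0_map : {linear Phi0 DH FH -> Phi0 EK FK} :=
  colim_desc (F := path_functor (cone_rep DH FH)) (g := Phi0_comp) Phi0_map_subproof.

Lemma Phi0_map_inj v x : Phi0_map (Phi0_inj DH FH v x) = Phi0_comp v x.
Proof. exact: (colim_desc_inj (F := path_functor (cone_rep DH FH))). Qed.

End Inclusion.

Section LocallyFiltered.
Variables (d : Order.disp_t) (I : porderType d).

Record locally_filtered (T : Type) (Y : set T) (X : I -> set T) : Prop :=
  LocallyFiltered {
    lf_cover : Y = \bigcup_(i in [set: I]) X i;
    lf_lt : forall i j, (i < j)%O -> X i `<=` X j;
    lf_filtered : forall i j x, (X i `&` X j) x ->
      exists k, [/\ (k <= i)%O, (k <= j)%O, X k x & X k `<=` X i `&` X j] }.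

Lemma lf_le T (Y : set T) (X : I -> set T) : locally_filtered Y X ->
  forall i j, (i <= j)%O -> X i `<=` X j.
Proof.
by move=> lfX i j; rewrite le_eqVlt => /orP[/eqP-> //|]; exact: lf_lt lfX i j.
Qed.

Record graph_locally_filtered (G : graph) (H : I -> subgraph G) : Prop :=
  GraphLocallyFiltered {
    glf_arr : locally_filtered setT (fun i => sarr (H i));
    glf_vert : locally_filtered setT (fun i => svert (H i)) }.

Variables (R : pzRingType) (G : graph) (H : I -> subgraph G).
Hypothesis lfH : graph_locally_filtered H.
Variables (E : set (vert G)) (E_ : I -> set (vert G)).
Hypothesis lfE : locally_filtered E E_.
Variable F : graph_rep R G.

Let FH i := rep_restr F (H i).
Let EH i := set_restr (H i) (E_ i).
Arguments EH i : clear implicits.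

Definition Phi_fmap i j (ij : (i <= j)%O) : {linear Phi (EH i) (FH i) -> Phi (EH j) (FH j)} :=
  Phi_map F (lf_le (glf_arr lfH) ij) (lf_le (glf_vert lfH) ij) (lf_le lfE ij).

Definition Phi0_fmap i j (ij : (i <= j)%O) : {linear Phi0 (EH i) (FH i) -> Phi0 (EH j) (FH j)} :=
  Phi0_map F (lf_le (glf_arr lfH) ij) (lf_le (glf_vert lfH) ij) (lf_le lfE ij).

Lemma dinj1_irr i a p q (x : F (src a)) :
  dinj (fun a => FH i (src a)) (exist _ a p) x
  = dinj (fun a => FH i (src a)) (exist _ a q) x.
Proof. by rewrite (Prop_irrelevance p q). Qed.

Fact Phi_fmap_id i x : @Phi_fmap i i (lexx i) x = x.
Proof.
apply: val_inj.
apply: (dsum_ext (f := ext1 F (lf_le (glf_arr lfH) (lexx i))) (g := idfun : {linear _ -> _})).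
by move=> -[a p] y; rewrite /ext1 /dsum_map dsum_desc_dinj; exact: dinj1_irr.
Qed.

Fact Phi_fmap_comp i j k (jk : (j <= k)%O) (ij : (i <= j)%O) x :
  Phi_fmap (le_trans ij jk) x = Phi_fmap jk (Phi_fmap ij x).
Proof.
apply: val_inj.
apply: (dsum_ext (f := ext1 F (lf_le (glf_arr lfH) (le_trans ij jk)))
  (g := ext1 F (lf_le (glf_arr lfH) jk) \o ext1 F (lf_le (glf_arr lfH) ij) : {linear _ -> _})).
move=> a y; rewrite [LHS]ext1_dinj.
have h : (ext1 F (lf_le (glf_arr lfH) jk) \o ext1 F (lf_le (glf_arr lfH) ij))
    (dinj (fun a => FH i (src a)) a y)
  = ext1 F (lf_le (glf_arr lfH) jk)
    (dinj (fun a => FH j (src a)) (incl (lf_le (glf_arr lfH) ij) a) y).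
  by congr (ext1 _ _ _); exact: ext1_dinj.
apply: etrans (esym h); rewrite [RHS]ext1_dinj; exact: dinj1_irr.
Qed.

Definition Phi_functor : functor R (poset_cat I) :=
  @Functor R (poset_cat I) (fun i => Phi (EH i) (FH i)) Phi_fmap Phi_fmap_id Phi_fmap_comp.

Fact Phi0_fmap_id i x : @Phi0_fmap i i (lexx i) x = x.
Proof.
apply: (colim_ext (F := path_functor (cone_rep (EH i) (FH i))) (f := Phi0_fmap (lexx i))
  (g := idfun : {linear _ -> _})) => -[[v p]|] y; rewrite [LHS]Phi0_map_inj //=.
exact: Phi0_inj_irr.
Qed.

Fact Phi0_fmap_comp i j k (jk : (j <= k)%O) (ij : (i <= j)%O) x :
  Phi0_fmap (le_trans ij jk) x = Phi0_fmap jk (Phi0_fmap ij x).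
Proof.
apply: (colim_ext (F := path_functor (cone_rep (EH i) (FH i))) (f := Phi0_fmap (le_trans ij jk))
  (g := Phi0_fmap jk \o Phi0_fmap ij : {linear _ -> _})) => v y.
rewrite [LHS]Phi0_map_inj.
have h : (Phi0_fmap jk \o Phi0_fmap ij) (Phi0_inj (EH i) (FH i) v y)
  = Phi0_fmap jk (@Phi0_comp R G F (H i) (H j) (E_ i) (E_ j) (lf_le (glf_vert lfH) ij) v y).
  by congr (Phi0_fmap jk _); exact: Phi0_map_inj.
apply: etrans (esym h).
case: v y {h} => [v|] y; apply: esym; rewrite Phi0_map_inj.
  exact: Phi0_inj_irr.
by [].
Qed.

Definition Phi0_functor : functor R (poset_cat I) :=
  @Functor R (poset_cat I) (fun i => Phi0 (EH i) (FH i)) Phi0_fmap Phi0_fmap_id Phi0_fmap_comp.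

End LocallyFiltered.

(* Main.v *)
(** Write [bar F] for the functor [c |-> (+)_(b -> c) F b] and [bsyz F] for the
    kernel of [bar F -> F].  Both are exact in [F], and [colim (bar F)] is the
    direct sum of all [F b], so that [ker (colim (bsyz F) -> colim (bar F))] is
    the first derived functor [colim_1 F] and iterating [bsyz] shifts dimension.
    A short exact sequence whose middle term is acyclic thus computes [colim_1]
    of its quotient, whichever the middle term is: both the standard resolution
    and ad hoc ones may be used.

    For a locally filtered cover, the functor sending [i] to the direct sum of
    given modules over the [i]-th piece is a filtered union of split functors,
    hence acyclic, with colimit the direct sum over the whole set.  The chain
    functors on arrows [C1], on vertices [C0], and on [E_ i] ([CE]) are of this
    kind, and since [CE i -> C0 i] is injective there is an exact sequence
    [0 -> Phi_i -> C1 (+) CE -> C0 -> Phi0_i -> 0].  With [B] the image in the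
    middle, [colim_2 Phi0 = colim_1 B = ker (colim Phi -> colim (C1 (+) CE))] and
    [colim_1 Phi0 = ker (colim B -> colim C0)]; the colimits of [C1 (+) CE] and
    [C0] being chain modules of the whole graph, this is the claim. *)

From Stdlib Require List.
Require Import Defs.
From HB Require Import structures.
From mathcomp Require Import all_boot all_order all_algebra.
From mathcomp Require Import boolp classical_sets.
Import Defs.

Set Implicit Arguments.
Unset Strict Implicit.
Unset Printing Implicit Defensive.

Import Order.TTheory GRing.Theory.

Local Open Scope classical_set_scope.
Local Open Scope ring_scope.

(** * Linear algebra *)

Section LinearAlgebra.
Variable R : pzRingType.

Section OfRelation.
Variables (M N : lmodType R) (r : M -> N -> Prop).
Hypothesis r_linear : forall a x x' y y',
  r x y -> r x' y' -> r (a *: x + x') (a *: y + y').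
Hypothesis r_total : forall x, exists y, r x y.
Hypothesis r_functional : forall y, r 0 y -> y = 0.

Let rel_fun x : N := sval (cid (r_total x)).

Let rel_funP x : r x (rel_fun x).
Proof. by rewrite /rel_fun; case: cid. Qed.

Let rel_inj x y y' : r x y -> r x y' -> y = y'.
Proof.
move=> ry ry'; apply/eqP; rewrite -subr_eq0; apply/eqP/r_functional.
by have := r_linear (-1) ry' ry; rewrite !scaleN1r addNr addrC.
Qed.

Let rel_fun_linear : linear rel_fun.
Proof.
move=> a x y; apply: rel_inj (rel_funP _) _.
by apply: r_linear; exact: rel_funP.
Qed.

HB.instance Definition _ := GRing.isLinear.Build R M N _ rel_fun rel_fun_linear.

(** By linearity two values at the same point differ by a value at 0, so any choice of values is
    forced and linear. Maps defined by a diagram chase are obtained from this, the relation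
    recording all choices of lifts at once. *)
Lemma linear_of_rel : exists f : {linear M -> N}, forall x y, r x y <-> f x = y.
Proof.
exists rel_fun => x y; split=> [rxy|<-]; last exact: rel_funP.
exact: rel_inj (rel_funP x) rxy.
Qed.

End OfRelation.

Lemma linear_inj (M N : lmodType R) (f : {linear M -> N}) :
  (forall x, f x = 0 -> x = 0) -> injective f.
Proof.
move=> f0 x y fxy; apply/eqP; rewrite -subr_eq0; apply/eqP/f0.
by rewrite linearB fxy subrr.
Qed.

Lemma linear_inj0 (M N : lmodType R) (f : {linear M -> N}) x :
  injective f -> f x = 0 -> x = 0.
Proof. by move=> fI fx; apply: fI; rewrite fx linear0. Qed.

Lemma exact_comp0 (A B C : lmodType R) (f : {linear A -> B}) (g : {linear B -> C}) x :
  exact_at f g -> g (f x) = 0.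
Proof. by move=> fg; apply/fg; exists x. Qed.

Section Corestriction.
Variables (M N : lmodType R) (S : submod N) (f : {linear M -> N}).
Hypothesis fS : forall x, S (f x).

Definition cores_fun x : subm S := sm_mk (fS x).

Fact cores_is_linear : linear cores_fun.
Proof. by move=> a x y; apply: val_inj; rewrite /= linearP. Qed.

HB.instance Definition _ := GRing.isLinear.Build R M (subm S) _ cores_fun cores_is_linear.

Definition cores : {linear M -> subm S} := cores_fun.

End Corestriction.

Lemma dsum_ind_gen (I : Type) (M : I -> lmodType R) (P : dsum M -> Prop) :
  P 0 -> (forall x y, P x -> P y -> P (x + y)) -> (forall i x, P (dinj M i x)) ->
  forall x, P x.
Proof.
move=> P0 PD Pi x; have [X xX] := dsum_fset x.
by rewrite (dsum_decomp xX); elim/big_ind: _.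
Qed.

(** Unlike in [dsum_ind_gen], only the components of the given [x] are to be treated, so that a
    hypothesis on its coordinates can be used. *)
Lemma dsum_ind_supp (I : Type) (M : I -> lmodType R) (P : dsum M -> Prop) x :
  P 0 -> (forall x y, P x -> P y -> P (x + y)) ->
  (forall i, P (dinj M i (dcoord x i))) -> P x.
Proof.
move=> P0 PD Pi; have [X xX] := dsum_fset x.
by rewrite (dsum_decomp xX); elim/big_ind: _ => // i _; exact: Pi.
Qed.

Section DsumMap.
Variables (I : Type) (M N : I -> lmodType R) (f : forall i, {linear M i -> N i}).

Definition dsum_mapi : {linear dsum M -> dsum N} := dsum_map (p := id) f.

Lemma dsum_mapi_dinj i x : dsum_mapi (dinj M i x) = dinj N i (f i x).
Proof. exact: dsum_desc_dinj. Qed.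

Lemma dcoord_mapi x i : dcoord (dsum_mapi x) i = f i (dcoord x i).
Proof.
elim/dsum_ind_gen: x => [|x y hx hy|j x].
- by rewrite linear0 !dcoord0 linear0.
- by rewrite linearD !dcoordD linearD hx hy.
rewrite dsum_mapi_dinj; have [e|ne] := pselect (j = i).
  by subst j; rewrite !dcoord_dinj.
by rewrite !dcoord_dinj_neq// linear0.
Qed.

Lemma dsum_mapi_inj : (forall i, injective (f i)) -> injective dsum_mapi.
Proof.
move=> fI x y xy; apply: dsumP => i; apply: (fI i).
by rewrite -!dcoord_mapi xy.
Qed.

Lemma dsum_mapi_im x :
  (forall i, exists y, f i y = dcoord x i) -> exists y, dsum_mapi y = x.
Proof.
move=> fx; apply: (@dsum_ind_supp _ _ (im_submod dsum_mapi)) => [|y z|i].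
- exact: sm0.
- exact: smD.
by have [y <-] := fx i; exists (dinj M i y); exact: dsum_mapi_dinj.
Qed.

End DsumMap.

End LinearAlgebra.

Lemma lcompE (R : pzRingType) (M N P : lmodType R) (f : {linear N -> P})
    (g : {linear M -> N}) x : (f \o g : {linear M -> P}) x = f (g x).
Proof. by []. Qed.

(** * Colimits are right exact *)

Section ColimitFacts.
Variables (R : pzRingType) (C : category).

Lemma colim_ind (F : functor R C) (P : colim F -> Prop) :
  (forall x y, P x -> P y -> P (x + y)) -> P 0 ->
  (forall c x, P (colim_inj F c x)) -> forall x, P x.
Proof.
move=> PD P0 Pi x; have [y <-] := qpi_surj x.
elim/dsum_ind_gen: y => [|y z|c y]; last exact: Pi.
- by rewrite linear0.
- by rewrite linearD; exact: PD.
Qed.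

Lemma colim_map_inj (F G : functor R C) (h : nattrans F G) c x :
  colim_map h (colim_inj F c x) = colim_inj G c (h c x).
Proof. exact: colim_desc_inj. Qed.

Lemma colim_map_comp (F G H : functor R C) (f : nattrans F G) (g : nattrans G H)
    (k : nattrans F H) :
  (forall c x, g c (f c x) = k c x) ->
  forall x, colim_map g (colim_map f x) = colim_map k x.
Proof.
move=> gf; apply: (colim_ext (f := colim_map g \o colim_map f : {linear _ -> _})).
by move=> c x; rewrite lcompE 3!colim_map_inj gf.
Qed.

Lemma colim_map_id (F : functor R C) (h : nattrans F F) :
  (forall c x, h c x = x) -> forall x, colim_map h x = x.
Proof.
move=> hE; apply: (colim_ext (g := idfun : {linear _ -> _})) => c x.
by rewrite colim_map_inj hE.
Qed.

Lemma colim_map0 (F G : functor R C) (h : nattrans F G) :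
  (forall c x, h c x = 0) -> forall x, colim_map h x = 0.
Proof.
move=> hE; apply: (colim_ext (g := \0 : {linear _ -> _})) => c x.
by rewrite colim_map_inj hE linear0.
Qed.

Lemma colim_map_square (F G H K : functor R C) (f : nattrans F G) (g : nattrans G H)
    (f' : nattrans F K) (g' : nattrans K H) :
  (forall c x, g c (f c x) = g' c (f' c x)) ->
  forall x, colim_map g (colim_map f x) = colim_map g' (colim_map f' x).
Proof.
move=> sq x; rewrite (colim_map_comp (k := nt_comp g f)) //.
by rewrite (colim_map_comp (k := nt_comp g f)) // => c y; rewrite /= sq.
Qed.

Lemma colim_map_surj (F G : functor R C) (h : nattrans F G) :
  (forall c, surj (h c)) -> surj (colim_map h).
Proof.
move=> hS; elim/colim_ind => [x y|| c x].
- exact: (@smD _ _ (im_submod (colim_map h))).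
- exact: (sm0 (im_submod (colim_map h))).
by have [y <-] := hS c x; exists (colim_inj F c y); exact: colim_map_inj.
Qed.

Section RightExact.
Variables (A B D : functor R C) (f : nattrans A B) (g : nattrans B D).
Hypothesis fg : forall c, exact_at (f c) (g c).
Hypothesis gS : forall c, surj (g c).

Let Q := quotm (im_submod (colim_map f)).
Let pr : {linear colim B -> Q} := qpi (im_submod (colim_map f)).

(** The kernel of [g c] is the image of [f c], which dies in the cokernel [Q]; the map from [B c] to
    [Q] thus factors through [g c]. *)
Let lift c : exists u : {linear D c -> Q}, forall b, u (g c b) = pr (colim_inj B c b).
Proof.
pose r (x : D c) (q : Q) := exists2 b, g c b = x & pr (colim_inj B c b) = q.
have [|x|q [b gb <-]|u uP] := @linear_of_rel R (D c) Q r.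
- move=> a x x' y y' [b <- <-] [b' <- <-]; exists (a *: b + b'); first exact: linearP.
  by rewrite !linearP.
- by have [b <-] := gS x; exists (pr (colim_inj B c b)), b.
- apply/(qpi_eq0 (im_submod (colim_map f))); have /fg[a <-] := gb; exists (colim_inj A c a).
  exact: colim_map_inj.
by exists u => b; apply/uP; exists b.
Qed.

Let u c := sval (cid (lift c)).
Let uE c b : u c (g c b) = pr (colim_inj B c b).
Proof. by rewrite /u; case: cid. Qed.

(** The maps [u] form a cocone from [D] to the cokernel [Q] of [colim_map f], and the induced map
    composed with [colim_map g] is the projection [pr]. What [colim_map g] kills is then killed by
    [pr], hence is in the image of [colim_map f]. *)
Lemma colim_right_exact : exact_at (colim_map f) (colim_map g).
Proof.
move=> y; split=> [gy0|[x <-]]; last first.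
  rewrite (colim_map_comp (k := nt_comp g f)) //; apply: colim_map0 => c z /=.
  exact: exact_comp0.
have u_cocone a b (h : Hom a b) x : u b (fmap D h x) = u a x.
  have [z <-] := gS x; rewrite -nt_natural !uE; congr (pr _).
  exact: colim_inj_nat.
have key x : colim_desc u_cocone (colim_map g x) = pr x.
  apply: (colim_ext (f := colim_desc u_cocone \o colim_map g : {linear _ -> _})) => c b.
  by rewrite lcompE colim_map_inj colim_desc_inj uE.
by apply/(qpi_eq0 (im_submod (colim_map f))); rewrite -[LHS]key gy0 linear0.
Qed.

End RightExact.

End ColimitFacts.

(** * The bar cover of a functor *)

Section BarFunctor.
Variables (R : pzRingType) (C : category).

Definition bidx (c : Ob C) := {b : Ob C & Hom b c}.

Definition bpush c d (g : Hom c d) (i : bidx c) : bidx d :=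
  existT _ (projT1 i) (compm g (projT2 i)).

Section Objects.
Variable F : functor R C.

Definition bar_obj c : lmodType R := dsum (fun i : bidx c => F (projT1 i)).

Definition bgen b c (f : Hom b c) : {linear F b -> bar_obj c} :=
  dinj (fun i : bidx c => F (projT1 i)) (existT _ b f).

Definition bar_fmap c d (g : Hom c d) : {linear bar_obj c -> bar_obj d} :=
  dsum_map (N := fun i : bidx d => F (projT1 i)) (p := bpush g)
    (fun i => (idfun : {linear F (projT1 i) -> F (projT1 i)})).

Lemma bar_fmap_gen b c d (g : Hom c d) (f : Hom b c) x :
  bar_fmap g (bgen f x) = bgen (compm g f) x.
Proof. by rewrite /bar_fmap /dsum_map /bgen dsum_desc_dinj. Qed.

Lemma bar_ext c (N : lmodType R) (f g : {linear bar_obj c -> N}) :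
  (forall b (h : Hom b c) x, f (bgen h x) = g (bgen h x)) -> forall x, f x = g x.
Proof. by move=> fg; apply: dsum_ext => -[b h] x; exact: fg. Qed.

Fact bar_fmap_id c x : bar_fmap (idm c) x = x.
Proof.
apply: (bar_ext (g := idfun : {linear _ -> _})) => b h y.
by rewrite bar_fmap_gen compm_idl.
Qed.

Fact bar_fmap_comp a b c (g : Hom b c) (f : Hom a b) x :
  bar_fmap (compm g f) x = bar_fmap g (bar_fmap f x).
Proof.
apply: (bar_ext (g := bar_fmap g \o bar_fmap f : {linear _ -> _})) => d h y.
by rewrite lcompE !bar_fmap_gen compmA.
Qed.

Definition bar : functor R C := Functor bar_fmap_id bar_fmap_comp.

Definition bdesc_comp (G : functor R C) (u : forall b, {linear F b -> G b}) c :
    {linear bar c -> G c} :=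
  dsum_desc (fun i : bidx c => fmap G (projT2 i) \o u (projT1 i)).

Lemma bdesc_gen (G : functor R C) (u : forall b, {linear F b -> G b}) b c (f : Hom b c) x :
  bdesc_comp u c (bgen f x) = fmap G f (u b x).
Proof. exact: dsum_desc_dinj. Qed.

Fact bdesc_natural (G : functor R C) (u : forall b, {linear F b -> G b}) a b (f : Hom a b) x :
  bdesc_comp u b (fmap bar f x) = fmap G f (bdesc_comp u a x).
Proof.
apply: (bar_ext (f := bdesc_comp u b \o bar_fmap f : {linear _ -> _})
  (g := fmap G f \o bdesc_comp u a : {linear _ -> _})) => c h y.
by rewrite 2!lcompE bar_fmap_gen !bdesc_gen fmap_comp.
Qed.

Definition bdesc (G : functor R C) (u : forall b, {linear F b -> G b}) : nattrans bar G :=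
  NatTrans (@bdesc_natural G u).

Definition bar_aug : nattrans bar F := bdesc (fun b => (idfun : {linear F b -> F b})).

Lemma bar_aug_gen b c (f : Hom b c) x : bar_aug c (bgen f x) = fmap F f x.
Proof. exact: bdesc_gen. Qed.

Lemma bar_aug_id c x : bar_aug c (bgen (idm c) x) = x.
Proof. by rewrite bar_aug_gen fmap_id. Qed.

Lemma bar_aug_surj c : surj (bar_aug c).
Proof. by move=> x; exists (bgen (idm c) x); exact: bar_aug_id. Qed.

Definition bsyz : functor R C := ker_functor bar_aug.
Definition bsyz_incl : nattrans bsyz bar := ker_incl bar_aug.

Lemma bsyz_exact c : exact_at (bsyz_incl c) (bar_aug c).
Proof.
move=> y; split=> [y0|[x <-]]; last exact: (sm_valS x).
by exists (@sm_mk _ _ (ker_submod (bar_aug c)) y y0).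
Qed.

Lemma bsyz_incl_inj c : injective (bsyz_incl c).
Proof. exact: val_inj. Qed.

Definition colim_bar_sum : {linear colim bar -> dsum F}.
Proof.
refine (@colim_desc R C bar _ (fun c => dsum_desc (fun i : bidx c => dinj F (projT1 i))) _).
move=> a b f x.
apply: (bar_ext (f := dsum_desc (fun i : bidx b => dinj F (projT1 i)) \o bar_fmap f
   : {linear _ -> _})) => c h y.
by rewrite lcompE bar_fmap_gen /bgen !dsum_desc_dinj.
Defined.

Lemma colim_bar_sum_gen b c (f : Hom b c) x :
  colim_bar_sum (colim_inj bar c (bgen f x)) = dinj F b x.
Proof. by rewrite /colim_bar_sum colim_desc_inj /bgen dsum_desc_dinj. Qed.

(** In the colimit the generator at [h : b -> c] equals the one at [idm b], of which it is the image
    under [h]. Sending [F b] to the generators at [idm b] is thus a left inverse. *)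
Lemma colim_bar_sum_inj : injective colim_bar_sum.
Proof.
pose k := dsum_desc (fun b => colim_inj bar b \o bgen (idm b)).
apply: (can_inj (g := k)).
apply: (colim_ext (f := k \o colim_bar_sum : {linear _ -> _}) (g := idfun : {linear _ -> _})).
move=> c; apply: (bar_ext (f := k \o colim_bar_sum \o colim_inj bar c : {linear _ -> _})).
move=> b h x; rewrite 2!lcompE colim_bar_sum_gen /k dsum_desc_dinj lcompE.
by rewrite -[LHS](colim_inj_nat (F := bar) h) bar_fmap_gen compm_idr.
Qed.

End Objects.

Section Maps.
Variables (F G : functor R C) (h : nattrans F G).

Definition bar_map_comp c : {linear bar F c -> bar G c} :=
  dsum_mapi (N := fun i : bidx c => G (projT1 i)) (fun i => h (projT1 i)).

Lemma bar_map_comp_gen b c (f : Hom b c) x :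
  bar_map_comp c (bgen F f x) = bgen G f (h b x).
Proof. exact: dsum_mapi_dinj. Qed.

Fact bar_map_natural a b (f : Hom a b) x :
  bar_map_comp b (fmap (bar F) f x) = fmap (bar G) f (bar_map_comp a x).
Proof.
apply: (bar_ext (f := bar_map_comp b \o bar_fmap F f : {linear _ -> _})
  (g := bar_fmap G f \o bar_map_comp a : {linear _ -> _})) => c k y.
by rewrite 2!lcompE bar_fmap_gen !bar_map_comp_gen bar_fmap_gen.
Qed.

Definition bar_map : nattrans (bar F) (bar G) := NatTrans bar_map_natural.

Lemma bar_map_gen b c (f : Hom b c) x : bar_map c (bgen F f x) = bgen G f (h b x).
Proof. exact: bar_map_comp_gen. Qed.

Lemma bar_aug_natural c x : bar_aug G c (bar_map c x) = h c (bar_aug F c x).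
Proof.
apply: (bar_ext (f := bar_aug G c \o bar_map c : {linear _ -> _})
  (g := h c \o bar_aug F c : {linear _ -> _})) => b f y.
by rewrite 2!lcompE bar_map_comp_gen !bdesc_gen nt_natural.
Qed.

Fact bsyz_map_subproof c x :
  ker_submod (bar_aug F c) x -> ker_submod (bar_aug G c) (bar_map c x).
Proof.
by move=> x0; have := bar_aug_natural x; rewrite (x0 : bar_aug F c x = 0) linear0.
Qed.

Fact bsyz_map_natural a b (f : Hom a b) (x : bsyz F a) :
  subm_map (@bsyz_map_subproof b) (fmap (bsyz F) f x)
  = fmap (bsyz G) f (subm_map (@bsyz_map_subproof a) x).
Proof. by apply: val_inj; exact: (nt_natural bar_map). Qed.

Definition bsyz_map : nattrans (bsyz F) (bsyz G) :=
  @NatTrans R C (bsyz F) (bsyz G) (fun c => subm_map (@bsyz_map_subproof c))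
    bsyz_map_natural.

Lemma bsyz_incl_natural c x :
  bsyz_incl G c (bsyz_map c x) = bar_map c (bsyz_incl F c x).
Proof. by []. Qed.

Lemma bar_map_inj c : (forall b, injective (h b)) -> injective (bar_map c).
Proof. by move=> hI; apply: dsum_mapi_inj => -[b f]; exact: hI. Qed.

Lemma bsyz_map_inj c : (forall b, injective (h b)) -> injective (bsyz_map c).
Proof.
by move=> hI x y /(congr1 val) /(bar_map_inj hI) xy; exact: val_inj.
Qed.

(** Both colimits embed into direct sums over the objects, where the map becomes the direct sum of
    the components of [h]. Colimits do not preserve injections in general; the connecting maps below
    rest on this case where they do. *)
Lemma colim_bar_map_inj : (forall b, injective (h b)) -> injective (colim_map bar_map).
Proof.
move=> hI; pose k := dsum_mapi (M := F) (N := G) (fun b => h b).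
have kE : forall x, colim_bar_sum G (colim_map bar_map x) = k (colim_bar_sum F x).
  apply: colim_ind => [x y hx hy||c].
  - by rewrite !linearD hx hy.
  - by rewrite !linear0.
  apply: dsum_ind_gen => [|x y hx hy|[b f] x].
  - by rewrite !linear0.
  - by rewrite !linearD hx hy.
  rewrite colim_map_inj bar_map_gen 2!colim_bar_sum_gen.
  by rewrite [RHS]dsum_mapi_dinj.
have kI : injective k by exact: dsum_mapi_inj.
by move=> x y xy; apply/colim_bar_sum_inj/kI; rewrite -!kE xy.
Qed.

End Maps.

End BarFunctor.

Arguments bsyz_exact {R C} F c.
Arguments bar_aug_surj {R C} F c.

(** * Derived colimits and short exact sequences *)

Section ShortExact.
Variables (R : pzRingType) (C : category).

Record short_exact (A B D : functor R C) (i : nattrans A B) (p : nattrans B D) : Prop :=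
  ShortExact {
    se_inj : forall c, injective (i c);
    se_exact : forall c, exact_at (i c) (p c);
    se_surj : forall c, surj (p c) }.

Arguments se_inj {A B D i p} _ c.
Arguments se_exact {A B D i p} _ c.
Arguments se_surj {A B D i p} _ c.

Lemma bsyz_short_exact (F : functor R C) : short_exact (bsyz_incl F) (bar_aug F).
Proof. by split=> c; [exact: bsyz_incl_inj|exact: bsyz_exact|exact: bar_aug_surj]. Qed.

Lemma ker_short_exact (F G : functor R C) (e : nattrans F G) :
  (forall c, surj (e c)) -> short_exact (ker_incl e) e.
Proof.
move=> eS; split=> // c; first exact: val_inj.
move=> y; split=> [y0|[x <-]]; last exact: (sm_valS x).
by exists (@sm_mk _ _ (ker_submod (e c)) y y0).
Qed.

Section Induced.
Variables (A B D : functor R C) (i : nattrans A B) (p : nattrans B D).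
Hypothesis ip : short_exact i p.

Lemma bar_map_short_exact : short_exact (bar_map i) (bar_map p).
Proof.
split=> c.
- by apply: bar_map_inj; exact: se_inj ip.
- move=> y; split=> [py|[x <-]].
    apply: dsum_mapi_im => k; apply/(se_exact ip _).
    by rewrite -[LHS](dcoord_mapi (fun j : bidx c => p (projT1 j))) [X in dcoord X]py.
  apply: dsumP => k; rewrite [LHS]dcoord_mapi [X in p _ X]dcoord_mapi.
  by rewrite dcoord0; apply: exact_comp0; exact: se_exact ip _.
- by move=> y; apply: dsum_mapi_im => k; exact: (se_surj ip _).
Qed.

(** The kernels of the augmentations, which map the short exact sequence of bar covers onto the
    given one, form a short exact sequence (nine lemma). *)
Lemma bsyz_map_short_exact : short_exact (bsyz_map i) (bsyz_map p).
Proof.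
have bip := bar_map_short_exact.
split=> c.
- by apply: bsyz_map_inj; exact: se_inj ip.
- move=> y; split=> [py|[x <-]]; last first.
    have h := exact_comp0 (bsyz_incl A c x) (se_exact bip c).
    by apply: (bsyz_incl_inj (F := D)); rewrite 2!bsyz_incl_natural h linear0.
  have /(se_exact bip c)[x xy] : bar_map p c (bsyz_incl B c y) = 0.
    exact: (congr1 val py).
  have x0 : bar_aug A c x = 0.
    apply: (se_inj ip); rewrite linear0 -bar_aug_natural xy.
    exact: (exact_comp0 _ (bsyz_exact B c)).
  have /(bsyz_exact _ _)[z zx] := x0; exists z.
  by apply: (bsyz_incl_inj (F := B)); rewrite bsyz_incl_natural zx xy.
- move=> y; have [x xy] := se_surj bip c (bsyz_incl D c y).
  have /(se_exact ip _)[a ax] : p c (bar_aug B c x) = 0.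
    by rewrite -bar_aug_natural xy; exact: (exact_comp0 _ (bsyz_exact D c)).
  (* The lift [x] of [y] need not be a syzygy: its augmentation is [i a]. Subtracting the generator
     of [bar A] at [idm c] with value [a] corrects this without changing the image in [bar D]. *)
  have /(bsyz_exact _ _)[z zx] : bar_aug B c (x - bar_map i c (bgen A (idm c) a)) = 0.
    by rewrite linearB bar_aug_natural bar_aug_id ax subrr.
  exists z; apply: (bsyz_incl_inj (F := D)).
  rewrite bsyz_incl_natural zx linearB xy (exact_comp0 _ (se_exact bip c)).
  by rewrite subr0.
Qed.

Lemma colim_short_exact : exact_at (colim_map i) (colim_map p).
Proof. by apply: colim_right_exact; [exact: se_exact ip|exact: se_surj ip]. Qed.

End Induced.

Lemma colim_bsyz_incl_natural (F G : functor R C) (h : nattrans F G) x :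
  colim_map (bsyz_incl G) (colim_map (bsyz_map h) x)
  = colim_map (bar_map h) (colim_map (bsyz_incl F) x).
Proof. exact: colim_map_square. Qed.

Lemma colim_bar_aug_natural (F G : functor R C) (h : nattrans F G) x :
  colim_map (bar_aug G) (colim_map (bar_map h) x)
  = colim_map h (colim_map (bar_aug F) x).
Proof. by apply: colim_map_square => c y; exact: bar_aug_natural. Qed.

Definition colim_L1 (F : functor R C) : lmodType R :=
  subm (ker_submod (colim_map (bsyz_incl F))).

(** This is the vanishing of [colim_L1 F] only; second derived functors are controlled by also
    requiring it of [bsyz F]. *)
Definition acyclic1 (F : functor R C) : Prop := injective (colim_map (bsyz_incl F)).

Section Connecting.
Variables (A B D : functor R C) (i : nattrans A B) (p : nattrans B D).
Hypotheses (ip : short_exact i p) (B_acyclic : acyclic1 B).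

(** This is the snake lemma for the rows [colim (bsyz -)] and [colim (bar -)], whose cokernel row is
    [colim]. The bar row is injective on the left by [colim_bar_map_inj], and the kernel at [B]
    vanishes, which makes the connecting map injective. *)
Lemma colim_connecting : exists delta : {linear colim_L1 D -> colim A},
  injective delta /\ exact_at delta (colim_map i).
Proof.
have Sip := bsyz_map_short_exact ip; have Tip := bar_map_short_exact ip.
have exS := colim_short_exact Sip; have exT := colim_short_exact Tip.
have exA := colim_short_exact (bsyz_short_exact A).
have exB := colim_short_exact (bsyz_short_exact B).
(* The snake: lift [g] to a class [b] over [B], pull its image in [colim (bar B)] back to [t] over
   [A], and project [t] to [colim A]. *)
pose r (g : colim_L1 D) (a : colim A) := exists b t,
  [/\ colim_map (bsyz_map p) b = val g,
      colim_map (bsyz_incl B) b = colim_map (bar_map i) t &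
      colim_map (bar_aug A) t = a].
have [|g|a [b [t [pb bt <-]]]|delta deltaP] := @linear_of_rel R (colim_L1 D) (colim A) r.
- move=> k g g' a a' [b [t [pb bt <-]]] [b' [t' [pb' bt' <-]]].
  by exists (k *: b + b'), (k *: t + t'); split; rewrite !linearP ?pb ?bt ?pb' ?bt'.
- have [b pb] := colim_map_surj (se_surj Sip) (val g).
  have /exT[t tb] : colim_map (bar_map p) (colim_map (bsyz_incl B) b) = 0.
    by rewrite -colim_bsyz_incl_natural pb; exact: (sm_valS g).
  by exists (colim_map (bar_aug A) t), b, t.
(* The result is independent of the lift: when [g] is 0, [b] comes from a syzygy class of [A], hence
   so does [t], which then dies in [colim A]. *)
- have /exS[b' b'b] : colim_map (bsyz_map p) b = 0 by rewrite pb.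
  suff -> : t = colim_map (bsyz_incl A) b' by exact: exact_comp0.
  apply: (colim_bar_map_inj (se_inj ip)).
  by rewrite -bt -colim_bsyz_incl_natural b'b.
exists delta; split.
  apply: linear_inj => g /deltaP[b [t [pb bt /exA[s st]]]].
  apply: val_inj; rewrite -pb linear0.
  suff -> : b = colim_map (bsyz_map i) s by exact: exact_comp0.
  by apply: B_acyclic; rewrite bt -st colim_bsyz_incl_natural.
move=> a; split=> [ia|[g /deltaP[b [t [pb bt <-]]]]]; last first.
  by rewrite -colim_bar_aug_natural -bt; exact: exact_comp0.
have [t ta] := colim_map_surj (bar_aug_surj A) a.
have /exB[b bt] : colim_map (bar_aug B) (colim_map (bar_map i) t) = 0.
  by rewrite colim_bar_aug_natural ta ia.
have g0 : ker_submod (colim_map (bsyz_incl D)) (colim_map (bsyz_map p) b).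
  apply: etrans (colim_bsyz_incl_natural p b) _.
  by rewrite bt; exact: exact_comp0.
by exists (sm_mk g0); apply/deltaP; exists b, t.
Qed.

End Connecting.

(** Dimension shifting. The connecting map of the syzygy sequence identifies [colim_L1 (bsyz D)]
    with the kernel of [colim (bsyz A) -> colim (bsyz B)]. As [colim (bsyz B)] and [colim (bar A)]
    both inject into [colim (bar B)], this is also the kernel of
    [colim (bsyz A) -> colim (bar A)]. *)
Lemma colim_L1_shift (A B D : functor R C) (i : nattrans A B) (p : nattrans B D) :
  short_exact i p -> acyclic1 B -> acyclic1 (bsyz B) ->
  exists s : {linear colim_L1 (bsyz D) -> colim_L1 A}, injective s /\ surj s.
Proof.
move=> ip Bac SBac.
have [delta [dI dex]] := colim_connecting (bsyz_map_short_exact ip) SBac.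
have dK x : ker_submod (colim_map (bsyz_incl A)) (delta x).
  have := exact_comp0 x dex => /(congr1 (colim_map (bsyz_incl B))).
  rewrite colim_bsyz_incl_natural linear0.
  exact: (linear_inj0 (colim_bar_map_inj (se_inj ip))).
pose s := cores dK; exists s.
split=> [x y /(congr1 val) /dI //|y].
have /dex[x xy] : colim_map (bsyz_map i) (val y) = 0.
  apply: Bac; rewrite linear0 colim_bsyz_incl_natural.
  by rewrite [X in colim_map (bar_map i) X](sm_valS y) linear0.
by exists x; apply: val_inj.
Qed.

(** A relative form of projectivity: [F] is a direct summand of [bar F], while the modules [F c] may
    be arbitrary. *)
Definition bar_split (F : functor R C) : Prop :=
  exists s : nattrans F (bar F), forall c x, bar_aug F c (s c x) = x.

Lemma projective_bar_split (F : functor R C) : projective F -> bar_split F.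
Proof.
pose id_F : nattrans F F := @NatTrans R C F F (fun c => idfun) (fun a b f x => erefl).
by move=> /(_ (bar F) F (bar_aug F) id_F) /(_ (bar_aug_surj F)).
Qed.

Section Split.
Variables (F : functor R C) (s : nattrans F (bar F)).
Hypothesis sK : forall c x, bar_aug F c (s c x) = x.

Fact bar_retr_subproof c x :
  ker_submod (bar_aug F c) ((idfun \- (s c \o bar_aug F c) : {linear _ -> _}) x).
Proof.
apply: etrans (linearB (bar_aug F c) x (s c (bar_aug F c x))) _.
by rewrite sK subrr.
Qed.

(** The idempotent complementary to the splitting [s]: the projection of [bar F] onto its summand
    [bsyz F]. *)
Definition bar_retr_comp c : {linear bar F c -> bsyz F c} := cores (@bar_retr_subproof c).

Fact bar_retr_natural a b (f : Hom a b) x :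
  bar_retr_comp b (fmap (bar F) f x) = fmap (bsyz F) f (bar_retr_comp a x).
Proof.
apply: val_inj.
apply: etrans (esym (linearB (fmap (bar F) f) x (s a (bar_aug F a x)))).
by congr (_ - _); rewrite -nt_natural -nt_natural.
Qed.

Definition bar_retr : nattrans (bar F) (bsyz F) := NatTrans bar_retr_natural.

Lemma bar_retrK c x : bar_retr c (bsyz_incl F c x) = x.
Proof.
apply: val_inj; apply: etrans (_ : bsyz_incl F c x - s c (bar_aug F c (bsyz_incl F c x)) = _).
  by [].
by rewrite (exact_comp0 _ (bsyz_exact F c)) linear0 subr0.
Qed.

End Split.

(** The inclusion of the syzygy has a natural retraction, and [colim_map] carries it to a retraction
    of colimits. *)
Lemma bar_split_acyclic1 (F : functor R C) : bar_split F -> acyclic1 F.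
Proof.
move=> [s sK]; apply: (can_inj (g := colim_map (bar_retr sK))) => x.
pose k := nt_comp (bar_retr sK) (bsyz_incl F).
rewrite (colim_map_comp (k := k)) //; apply: colim_map_id => c y.
exact: bar_retrK.
Qed.

(** The comultiplication of the comonad [bar]; it splits the bar cover of [bar F] for every [F]. *)
Definition bar_comult (F : functor R C) : nattrans (bar F) (bar (bar F)) :=
  bdesc (G := bar (bar F)) (fun b => bgen (bar F) (idm b) \o bgen F (idm b)).

Lemma bar_comultK (F : functor R C) c x :
  bar_aug (bar F) c (bar_comult F c x) = x.
Proof.
elim/dsum_ind_gen: x => [|x y hx hy|[b f] x]; first by rewrite !linear0.
  by rewrite !linearD hx hy.
rewrite -/(bgen F f x) bdesc_gen (nt_natural (bar_aug (bar F))) lcompE bar_aug_id.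
by rewrite [LHS]bar_fmap_gen compm_idr.
Qed.

(** [bsyz F] is a retract of [bar F], and a retract of a split functor is split. *)
Lemma bar_split_bsyz (F : functor R C) : bar_split F -> bar_split (bsyz F).
Proof.
move=> [s sK].
exists (nt_comp (bar_map (bar_retr sK)) (nt_comp (bar_comult F) (bsyz_incl F))) => c x.
rewrite [X in bar_aug _ _ X]lcompE.
rewrite bar_aug_natural [X in bar_aug _ _ X]lcompE bar_comultK.
exact: bar_retrK.
Qed.

End ShortExact.

(** * Locally split functors *)

Section LocallySplit.
Variables (R : pzRingType) (C : category).

Definition hit (Q F : functor R C) (h : nattrans Q F) c (x : F c) : Prop :=
  exists q, h c q = x.

Fixpoint hits (Q F : functor R C) (h : nattrans Q F) (s : seq {c : Ob C & F c}) : Prop :=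
  if s is z :: s' then hit h (projT2 z) /\ hits h s' else True.

Lemma hits_cat (Q F : functor R C) (h : nattrans Q F) s t :
  hits h (s ++ t) -> hits h s /\ hits h t.
Proof. by elim: s => //= z s IHs [hz /IHs[]]. Qed.

(* A relation witnessing that a class vanishes only involves finitely many
   elements, so this is enough for acyclicity. *)
Definition locally_split (F : functor R C) : Prop :=
  forall s : seq {c : Ob C & F c}, exists (Q : functor R C) (h : nattrans Q F),
    [/\ bar_split Q, forall c, injective (h c) & hits h s].

Section Supports.
Variable F : functor R C.

(** The finite list depends on [t] alone, so it can be fixed before [Q] and [h] are chosen. The next
    two lemmas are uniform in the same way. *)
Lemma bar_hit c (t : bar F c) : exists s : seq {c : Ob C & F c},
  forall (Q : functor R C) (h : nattrans Q F), hits h s ->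
  hit (bar_map h) t.
Proof.
elim/dsum_ind_gen: t => [|x y [s hs] [t ht]|[b f] x].
- by exists [::] => Q h _; exists 0; exact: linear0.
- exists (s ++ t) => Q h /hits_cat[/hs[x' x'E] /ht[y' y'E]].
  by exists (x' + y'); apply: etrans (linearD (bar_map h c) _ _) _; congr (_ + _).
- exists [:: existT _ b x] => Q h [[q qx] _]; exists (bgen Q f q).
  by rewrite bar_map_gen qx.
Qed.

Lemma bsyz_hit c (t : bsyz F c) : exists s : seq {c : Ob C & F c},
  forall (Q : functor R C) (h : nattrans Q F), (forall b, injective (h b)) ->
  hits h s -> hit (bsyz_map h) t.
Proof.
have [s sP] := bar_hit (bsyz_incl F c t); exists s => Q h hI /sP[q qt].
(* Injectivity of [h] reflects the kernel condition, so the preimage [q] of a syzygy is itself a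
   syzygy. *)
have q0 : bar_aug Q c q = 0.
  apply: hI; rewrite linear0 -bar_aug_natural [X in bar_aug F c X]qt.
  exact: (exact_comp0 t (bsyz_exact F c)).
have [u uq] := (bsyz_exact Q c q).1 q0; exists u.
apply: (bsyz_incl_inj (F := F)).
by rewrite bsyz_incl_natural uq.
Qed.

Lemma colim_bsyz_hit (y : colim (bsyz F)) : exists s : seq {c : Ob C & F c},
  forall (Q : functor R C) (h : nattrans Q F), (forall b, injective (h b)) ->
  hits h s -> exists z, colim_map (bsyz_map h) z = y.
Proof.
elim/colim_ind: y => [x y [s hs] [t ht]||c x].
- exists (s ++ t) => Q h hI /hits_cat[/(hs _ _ hI)[x' <-] /(ht _ _ hI)[y' <-]].
  by exists (x' + y'); exact: linearD.
- by exists [::] => Q h _ _; exists 0; exact: linear0.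
- have [s sP] := bsyz_hit x; exists s => Q h hI /(sP _ _ hI)[q qx].
  exists (colim_inj (bsyz Q) c q).
  by rewrite colim_map_inj qx.
Qed.

(** A class that dies in [colim (bar F)] comes from a class [z] over a split subfunctor [Q]. Since
    [colim (bar Q)] injects into [colim (bar F)], [z] already dies in [colim (bar Q)], and [Q] is
    acyclic. *)
Lemma locally_split_acyclic1 : locally_split F -> acyclic1 F.
Proof.
move=> Fls; apply: linear_inj => y y0.
have [s sP] := colim_bsyz_hit y; have [Q [h [Qs hI hs]]] := Fls s.
have [z zy] := sP Q h hI hs.
suff z0 : z = 0 by rewrite -zy z0 linear0.
apply: (bar_split_acyclic1 Qs); apply: (colim_bar_map_inj hI).
by rewrite -colim_bsyz_incl_natural zy y0 !linear0.
Qed.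

Lemma locally_split_bsyz : locally_split F -> locally_split (bsyz F).
Proof.
move=> Fls l.
have [s sP] : exists s : seq {c : Ob C & F c},
    forall (Q : functor R C) (h : nattrans Q F), (forall b, injective (h b)) ->
    hits h s -> hits (bsyz_map h) l.
  elim: l => [|[c t] l [s sP]]; first by exists [::].
  have [s' s'P] := bsyz_hit t; exists (s' ++ s) => Q h hI /hits_cat[hs' hs].
  by split; [exact: s'P|exact: sP].
have [Q [h [Qs hI hs]]] := Fls s; exists (bsyz Q), (bsyz_map h); split.
- exact: bar_split_bsyz.
- by move=> c; exact: bsyz_map_inj.
- exact: sP.
Qed.

End Supports.

End LocallySplit.

(** * Products of two functors *)

Section ProductFunctor.
Variables (R : pzRingType) (C : category).

Section Pairing.
Variables (M N P : lmodType R).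

Definition pair_lin_fun (f : {linear P -> M}) (g : {linear P -> N}) x : M * N := (f x, g x).

Fact pair_lin_is_linear f g : linear (pair_lin_fun f g).
Proof. by move=> a x y; rewrite /pair_lin_fun !linearP. Qed.

HB.instance Definition _ f g :=
  GRing.isLinear.Build R P (M * N)%type _ (pair_lin_fun f g) (pair_lin_is_linear f g).

Definition pair_lin f g : {linear P -> (M * N)%type} := pair_lin_fun f g.

Definition copair_lin_fun (f : {linear M -> P}) (g : {linear N -> P}) (x : M * N) : P :=
  f x.1 + g x.2.

Fact copair_lin_is_linear f g : linear (copair_lin_fun f g).
Proof. by move=> a x y; rewrite /copair_lin_fun !linearP scalerDr addrACA. Qed.

HB.instance Definition _ f g :=
  GRing.isLinear.Build R (M * N)%type P _ (copair_lin_fun f g) (copair_lin_is_linear f g).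

Definition copair_lin f g : {linear (M * N)%type -> P} := copair_lin_fun f g.

End Pairing.

Variables F G : functor R C.

Definition prod_obj c : lmodType R := (F c * G c)%type.

(** The projections are copairings with a zero map, which gives their linearity; [prod_fstE] and
    [prod_sndE] remove the added zero. *)
Definition prod_fst c : {linear prod_obj c -> F c} := copair_lin idfun \0.
Definition prod_snd c : {linear prod_obj c -> G c} := copair_lin \0 idfun.

Lemma prod_fstE c x : prod_fst c x = x.1. Proof. exact: addr0. Qed.
Lemma prod_sndE c x : prod_snd c x = x.2. Proof. exact: add0r. Qed.

Definition prod_fmap a b (f : Hom a b) : {linear prod_obj a -> prod_obj b} :=
  pair_lin (fmap F f \o prod_fst a) (fmap G f \o prod_snd a).

Lemma prod_fmapE a b (f : Hom a b) x : prod_fmap f x = (fmap F f x.1, fmap G f x.2).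
Proof. by congr (_, _); rewrite lcompE ?prod_fstE ?prod_sndE. Qed.

Fact prod_fmap_id a x : prod_fmap (idm a) x = x.
Proof. by rewrite prod_fmapE !fmap_id; case: x. Qed.

Fact prod_fmap_comp a b c (g : Hom b c) (f : Hom a b) x :
  prod_fmap (compm g f) x = prod_fmap g (prod_fmap f x).
Proof. by rewrite 3!prod_fmapE !fmap_comp. Qed.

Definition prod_functor : functor R C := Functor prod_fmap_id prod_fmap_comp.

Fact prod_fst_natural a b (f : Hom a b) x :
  prod_fst b (fmap prod_functor f x) = fmap F f (prod_fst a x).
Proof. by rewrite [X in prod_fst b X]prod_fmapE !prod_fstE. Qed.

Fact prod_snd_natural a b (f : Hom a b) x :
  prod_snd b (fmap prod_functor f x) = fmap G f (prod_snd a x).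
Proof. by rewrite [X in prod_snd b X]prod_fmapE !prod_sndE. Qed.

Definition prod_pr1 : nattrans prod_functor F :=
  @NatTrans R C prod_functor F prod_fst prod_fst_natural.
Definition prod_pr2 : nattrans prod_functor G :=
  @NatTrans R C prod_functor G prod_snd prod_snd_natural.

Definition prod_pair (H : functor R C) (f : nattrans H F) (g : nattrans H G) :
  nattrans H prod_functor.
Proof.
refine (@NatTrans R C H prod_functor (fun c => pair_lin (f c) (g c)) _) => a b k x.
by rewrite [RHS]prod_fmapE /= -!nt_natural.
Defined.

Definition prod_copair (H : functor R C) (f : nattrans F H) (g : nattrans G H) :
  nattrans prod_functor H.
Proof.
refine (@NatTrans R C prod_functor H (fun c => copair_lin (f c) (g c)) _) => a b k x.
by rewrite [X in copair_lin _ _ X]prod_fmapE [RHS]linearD -!nt_natural.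
Defined.

Definition zero_nt (H K : functor R C) : nattrans H K.
Proof.
by refine (@NatTrans R C H K (fun c => \0) _) => a b k x; rewrite /= linear0.
Defined.

Definition id_nt (H : functor R C) : nattrans H H :=
  @NatTrans R C H H (fun c => idfun) (fun a b f x => erefl).

Definition prod_in1 : nattrans F prod_functor := prod_pair (id_nt F) (zero_nt F G).
Definition prod_in2 : nattrans G prod_functor := prod_pair (zero_nt G F) (id_nt G).

Lemma prod_decomp c (x : prod_functor c) :
  x = prod_in1 c (prod_pr1 c x) + prod_in2 c (prod_pr2 c x).
Proof.
case: x => x y; rewrite [X in prod_in1 c X]prod_fstE [X in prod_in2 c X]prod_sndE.
by congr (_, _); rewrite ?addr0 ?add0r.
Qed.

Lemma colim_prod_decomp (x : colim prod_functor) :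
  x = colim_map prod_in1 (colim_map prod_pr1 x) + colim_map prod_in2 (colim_map prod_pr2 x).
Proof.
elim/colim_ind: x => [x y hx hy||c x].
- by rewrite !linearD addrACA -hx -hy.
- by rewrite !linear0 addr0.
by rewrite 4!colim_map_inj -linearD -prod_decomp.
Qed.

(** [bsyz] and [colim] are additive, so a class is the sum of its two components, each of which
    vanishes by naturality and acyclicity. *)
Lemma prod_acyclic1 : acyclic1 F -> acyclic1 G -> acyclic1 prod_functor.
Proof.
move=> Fac Gac; apply: linear_inj => y y0.
have bar_decomp c (t : bar prod_functor c) :
    t = bar_map prod_in1 c (bar_map prod_pr1 c t) + bar_map prod_in2 c (bar_map prod_pr2 c t).
  elim/dsum_ind_gen: t => [|x z hx hz|[b f] x].
  - by rewrite !linear0 addr0.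
  - by rewrite !linearD addrACA -hx -hz.
  rewrite -/(bgen prod_functor f x) 4!bar_map_gen -[RHS](linearD (bgen prod_functor f)).
  by rewrite -prod_decomp.
have -> : y = colim_map (bsyz_map prod_in1) (colim_map (bsyz_map prod_pr1) y)
            + colim_map (bsyz_map prod_in2) (colim_map (bsyz_map prod_pr2) y).
  elim/colim_ind: y {y0} => [x y hx hy||c x].
  - by rewrite !linearD addrACA -hx -hy.
  - by rewrite !linear0 addr0.
  rewrite 4!colim_map_inj -linearD; congr (colim_inj _ c _).
  by apply: val_inj; exact: bar_decomp.
have pr10 : colim_map (bsyz_map prod_pr1) y = 0.
  by apply: Fac; rewrite colim_bsyz_incl_natural y0 !linear0.
have pr20 : colim_map (bsyz_map prod_pr2) y = 0.
  by apply: Gac; rewrite colim_bsyz_incl_natural y0 !linear0.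
by rewrite pr10 pr20 !linear0 addr0.
Qed.

End ProductFunctor.

(** * Comparison with the standard resolution *)

Section DerivedColimits.
Variables (R : pzRingType) (C : category).

Lemma linear_inverse (M N : lmodType R) (f : {linear M -> N}) :
  injective f -> surj f -> exists g : {linear N -> M}, injective g /\ surj g.
Proof.
move=> fI fS; have [|y|x fx|g gP] := @linear_of_rel R N M (fun y x => f x = y).
- by move=> a y y' x x' <- <-; exact: linearP.
- by have [x] := fS y; exists x.
- exact: linear_inj0 fI fx.
exists g; split=> [|x]; last by exists (f x); apply/gP.
by move=> y y' yy'; have /gP <- := erefl (g y); have /gP <- := erefl (g y'); rewrite yy'.
Qed.

(** Both [u] and [v] identify their source with the kernel of [f]. *)
Lemma linear_same_image (M N X Y : lmodType R) (u : {linear M -> X})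
    (v : {linear N -> X}) (f : {linear X -> Y}) :
  injective u -> injective v -> exact_at u f -> exact_at v f ->
  exists w : {linear M -> N}, injective w /\ surj w.
Proof.
move=> uI vI uf vf; have [|m|n m0|w wP] := @linear_of_rel R M N (fun m n => v n = u m).
- by move=> a m m' n n' nm nm'; rewrite !linearP nm nm'.
- by have /vf[n nm] := exact_comp0 m uf; exists n.
- by apply: linear_inj0 vI _; rewrite m0 linear0.
exists w; split.
  by apply: linear_inj => m /wP um; apply: linear_inj0 uI _; rewrite -um linear0.
by move=> n; have /uf[m mn] := exact_comp0 n vf; exists m; apply/wP.
Qed.

Lemma exact_at_comp (M N X Y : lmodType R) (w : {linear M -> N}) (u : {linear N -> X})
    (f : {linear X -> Y}) :
  surj w -> exact_at u f -> exact_at (u \o w : {linear M -> X}) f.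
Proof.
move=> wS uf y; rewrite uf; split=> [[n <-]|[m <-]]; last by exists (w m).
by have [m <-] := wS n; exists m.
Qed.

Lemma linear_comp_inj (M N X : lmodType R) (w : {linear M -> N}) (u : {linear N -> X}) :
  injective u -> injective w -> injective (u \o w : {linear M -> X}).
Proof. by move=> uI wI x y /uI /wI. Qed.

Lemma linear_comp_surj (M N X : lmodType R) (w : {linear M -> N}) (u : {linear N -> X}) :
  surj u -> surj w -> surj (u \o w : {linear M -> X}).
Proof. by move=> uS wS x; have [y <-] := uS x; have [z <-] := wS y; exists z. Qed.

Section Syzygies.
Variable F : functor R C.

Let K n := syzygy F n.
Let cover n : nattrans (std_obj F n) (K n) := free_cover (K n).
Let incl_K n : nattrans (K n.+1) (std_obj F n) := ker_incl (cover n).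

Let cover_ses n : short_exact (incl_K n) (cover n).
Proof. by apply: ker_short_exact => c; exact: free_cover_surj. Qed.

Let cover_surj n : surj (colim_map (cover n)).
Proof. exact: colim_map_surj (se_surj (cover_ses n)). Qed.

Let dE n x : colim_map (std_d F n) x = colim_map (incl_K n) (colim_map (cover n.+1) x).
Proof. by rewrite (colim_map_comp (k := std_d F n)). Qed.

Let cycle n := subm (ker_submod (colim_map (std_d F n))).

(** With [P] the standard resolution, the cycles of degree [n.+1] are the preimage in
    [colim P_(n+1)] of the kernel of [colim K_(n+1) -> colim P_n]. By right exactness the boundaries
    are what dies in [colim K_(n+1)], so the homology is that kernel. *)
Lemma colimn_syzygy n : exists u : {linear colimn n.+1 F -> colim (K n.+1)},
  injective u /\ exact_at u (colim_map (incl_K n)).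
Proof.
pose u0 : {linear cycle n -> colim (K n.+1)} :=
  colim_map (cover n.+1) \o (val : {linear cycle n -> colim (std_obj F n.+1)}).
pose B := chain_boundaries (fun n => colim_map (std_d F n)) n.+1.
have u0B x : B x -> u0 x = 0.
  move=> [z zx]; have -> : u0 x = colim_map (cover n.+1) (val x) by [].
  by rewrite -zx dE; exact: (exact_comp0 _ (colim_short_exact (cover_ses n.+1))).
exists (quot_desc u0B); split.
  apply: linear_inj => x; have [y <-] := qpi_surj x; rewrite quot_descE => y0.
  apply/qpi_eq0; have /(colim_short_exact (cover_ses n.+1))[z zy] := y0.
  have [w wz] := cover_surj z; exists w.
  by apply: etrans (dE w) _; rewrite wz.
move=> k; split=> [k0|[x <-]].
  have [w wk] := cover_surj k.
  have wcyc : ker_submod (colim_map (std_d F n)) w by apply: etrans (dE w) _; rewrite wk.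
  by exists (qpi B (sm_mk wcyc)); rewrite quot_descE -[RHS]wk.
have [y <-] := qpi_surj x; rewrite quot_descE.
have -> : u0 y = colim_map (cover n.+1) (val y) by [].
by rewrite -dE; exact: (sm_valS y).
Qed.

Let std_split n : bar_split (std_obj F n).
Proof. exact: (projective_bar_split (@free_projective R C (K n))). Qed.

Let std_acyclic1 n : acyclic1 (std_obj F n).
Proof. exact: bar_split_acyclic1. Qed.

Lemma colimn_L1_syzygy n : exists w : {linear colimn n.+1 F -> colim_L1 (K n)},
  injective w /\ surj w.
Proof.
have [u [uI uex]] := colimn_syzygy n.
have [v [vI vex]] := colim_connecting (cover_ses n) (std_acyclic1 (n := n)).
exact: linear_same_image uI vI uex vex.
Qed.

(** The degree 2 derived functor is [colim_L1] of the first standard syzygy; shifting along the free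
    cover of [F] trades this for the bar syzygy, which does not refer to the resolution. *)
Lemma colim2_L1 : exists w : {linear colimn 2 F -> colim_L1 (bsyz F)},
  injective w /\ surj w.
Proof.
have [w [wI wS]] := colimn_L1_syzygy 1.
have [s [sI sS]] := colim_L1_shift (cover_ses 0) (std_acyclic1 (n := 0))
  (bar_split_acyclic1 (bar_split_bsyz (std_split 0))).
have [t [tI tS]] := linear_inverse sI sS.
exists (t \o w); split; [exact: linear_comp_inj tI wI|exact: linear_comp_surj tS wS].
Qed.

End Syzygies.

(** * Derived colimits from an acyclic resolution *)

Section AcyclicResolution.
Variables (F X Y Z : functor R C) (p : nattrans X F).
Variables (e : nattrans Y (ker_functor p)) (j : nattrans Z Y).
Hypotheses (p_surj : forall c, surj (p c)) (je : short_exact j e).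
Hypotheses (X_acyclic : acyclic1 X) (SX_acyclic : acyclic1 (bsyz X)).
Hypothesis Y_acyclic : acyclic1 Y.

(** For the exact sequence [0 -> Z -> Y -> X -> F -> 0], shift along [X -> F] to reach
    [colim_L1 (ker_functor p)], then apply the connecting map of [Z -> Y -> ker_functor p]. *)
Lemma colim2_acyclic : exists f : {linear colimn 2 F -> colim Z},
  injective f /\ exact_at f (colim_map j).
Proof.
have [w [wI wS]] := colim2_L1 F.
have [s [sI sS]] := colim_L1_shift (ker_short_exact p_surj) X_acyclic SX_acyclic.
have [d [dI dex]] := colim_connecting je Y_acyclic.
pose sw : {linear colimn 2 F -> colim_L1 (ker_functor p)} := s \o w.
exists (d \o sw); split; last exact: exact_at_comp (linear_comp_surj sS wS) dex.
exact: linear_comp_inj dI (linear_comp_inj sI wI).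
Qed.

Lemma colim1_acyclic : exists u : {linear colimn 1 F -> colim (ker_functor p)},
  injective u /\ exact_at u (colim_map (ker_incl p)).
Proof.
have [w [wI wS]] := colimn_L1_syzygy F 0.
have [d [dI dex]] := colim_connecting (ker_short_exact p_surj) X_acyclic.
exists (d \o w); split; [exact: linear_comp_inj dI wI|exact: exact_at_comp wS dex].
Qed.

End AcyclicResolution.

End DerivedColimits.

(** * Direct sums over the pieces of a cover *)

Section Families.
Variables (R : pzRingType) (T : Type) (M : T -> lmodType R).

Definition fam (A : set T) : lmodType R := dsum (fun x : A => M (sval x)).

Definition supported (A : set T) (f : dsum M) : Prop :=
  forall t, ~ A t -> dcoord f t = 0.

Lemma supported_dinj (A : set T) t (m : M t) : A t -> supported A (dinj M t m).
Proof. by move=> At u Au; apply: dcoord_dinj_neq => tu; apply: Au; rewrite -tu. Qed.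

Lemma supportedN (A : set T) f : supported A f -> supported A (- f).
Proof. by move=> fA t At; rewrite dcoordN fA // oppr0. Qed.

Section OneSet.
Variable A : set T.

(** Extension by zero to the ambient sum. As it is injective, families over different subsets can be
    compared there, without transport along membership proofs. *)
Definition tot : {linear fam A -> dsum M} :=
  dsum_map (N := M) (p := fun x : A => sval x)
    (fun x => (idfun : {linear M (sval x) -> M (sval x)})).

Lemma tot_dinj (x : A) (m : M (sval x)) :
  tot (dinj (fun x : A => M (sval x)) x m) = dinj M (sval x) m.
Proof. by rewrite /tot /dsum_map dsum_desc_dinj. Qed.

Definition res_comp t : {linear M t -> fam A} :=
  if pselect (A t) is left At
  then dinj (fun x : A => M (sval x)) (exist _ t (mem_set At)) else \0.

Definition res : {linear dsum M -> fam A} := dsum_desc res_comp.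

Lemma res_dinj t p (m : M t) :
  res (dinj M t m) = dinj (fun x : A => M (sval x)) (exist _ t p) m.
Proof.
rewrite /res dsum_desc_dinj /res_comp; case: pselect => [At|/(_ (set_mem p))//].
by rewrite (Prop_irrelevance (mem_set At) p).
Qed.

Lemma totK f : res (tot f) = f.
Proof.
elim/dsum_ind_gen: f => [|f g hf hg|[t p] m].
- by rewrite !linear0.
- by rewrite !linearD hf hg.
by rewrite tot_dinj (res_dinj p).
Qed.

Lemma tot_inj : injective tot.
Proof. exact: can_inj totK. Qed.

Lemma tot_supported f : supported A (tot f).
Proof.
elim/dsum_ind_gen: f => [|f g hf hg|[t p] m] u Au.
- by rewrite linear0 dcoord0.
- by rewrite linearD dcoordD hf // hg // addr0.
by rewrite tot_dinj; exact: supported_dinj (set_mem p) _ Au.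
Qed.

Lemma resK f : supported A f -> tot (res f) = f.
Proof.
move=> fA; apply: (@dsum_ind_supp _ _ _ (fun g => tot (res g) = g)) => [|g h hg hh|t].
- by rewrite !linear0.
- by rewrite !linearD hg hh.
have [At|At] := pselect (A t); last by rewrite fA // !linear0.
by rewrite (res_dinj (mem_set At)) tot_dinj.
Qed.

Lemma dcoord_tot f (x : A) : dcoord (tot f) (sval x) = dcoord f x.
Proof.
elim/dsum_ind_gen: f => [|f g hf hg|y m].
- by rewrite linear0 !dcoord0.
- by rewrite linearD !dcoordD hf hg.
rewrite tot_dinj; have [e|ne] := pselect (y = x).
  by subst y; rewrite !dcoord_dinj.
rewrite [RHS]dcoord_dinj_neq // dcoord_dinj_neq // => e; apply: ne.
exact: val_inj.
Qed.

End OneSet.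

Arguments tot {A}.

Lemma tot_eq_dinj (A B : set T) t p q (m : M t) :
  tot (A := A) (dinj (fun x : A => M (sval x)) (exist _ t p) m)
  = tot (A := B) (dinj (fun x : B => M (sval x)) (exist _ t q) m).
Proof. by rewrite !tot_dinj. Qed.

Lemma supported_sub (A B : set T) f : A `<=` B -> supported A f -> supported B f.
Proof. by move=> AB fA t Bt; apply: fA => /AB. Qed.

Lemma resK_sub (A B : set T) (f : fam A) : A `<=` B -> tot (res B (tot f)) = tot f.
Proof. by move=> AB; apply: resK; apply: supported_sub AB _; exact: tot_supported. Qed.

(** * The functor of families over the pieces and its colimit *)

Section Functor.
Variables (d : Order.disp_t) (I : porderType d).
Variables (X : I -> set T) (X_le : forall i j, (i <= j)%O -> X i `<=` X j).

Definition fam_map i j (ij : (i <= j)%O) : {linear fam (X i) -> fam (X j)} :=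
  res (X j) \o tot (A := X i).

Lemma tot_fam_map i j (ij : (i <= j)%O) f : tot (fam_map ij f) = tot f.
Proof. by rewrite lcompE resK_sub //; exact: X_le. Qed.

Fact fam_map_id i f : @fam_map i i (lexx i) f = f.
Proof. exact: totK. Qed.

Fact fam_map_comp i j k (jk : (j <= k)%O) (ij : (i <= j)%O) f :
  fam_map (le_trans ij jk) f = fam_map jk (fam_map ij f).
Proof. by apply: tot_inj; rewrite !tot_fam_map. Qed.

Definition fam_functor : functor R (poset_cat I) :=
  @Functor R (poset_cat I) (fun i => fam (X i)) fam_map fam_map_id fam_map_comp.

Lemma tot_fmap i j (ij : @Hom (poset_cat I) i j) f : tot (fmap fam_functor ij f) = tot f.
Proof. exact: tot_fam_map. Qed.

Definition colim_tot : {linear colim fam_functor -> dsum M} :=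
  @colim_desc R (poset_cat I) fam_functor _ (fun i => tot (A := X i)) tot_fmap.

Lemma colim_tot_inj i f : colim_tot (colim_inj fam_functor i f) = tot f.
Proof. by rewrite /colim_tot colim_desc_inj. Qed.

Lemma colim_res i k f : (k <= i)%O -> supported (X k) f ->
  colim_inj fam_functor i (res (X i) f) = colim_inj fam_functor k (res (X k) f).
Proof.
move=> ki fk; rewrite -(colim_inj_nat (F := fam_functor) (ki : @Hom (poset_cat I) k i)).
congr (colim_inj _ _ _); apply: tot_inj; rewrite tot_fmap !resK //.
exact: supported_sub (X_le ki) fk.
Qed.

Hypothesis X_filtered : forall i j x, (X i `&` X j) x ->
  exists k, [/\ (k <= i)%O, (k <= j)%O, X k x & X k `<=` X i `&` X j].

Let sec_comp t : {linear M t -> colim fam_functor} :=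
  if pselect (exists i, X i t) is left e
  then colim_inj fam_functor (sval (cid e)) \o (res (X (sval (cid e))) \o dinj M t
    : {linear M t -> fam_functor _})
  else \0.

(** The class does not depend on the piece chosen: two pieces containing [t] contain a smaller one
    through [t], from which both classes come. *)
Let sec_compE t (m : M t) i :
  X i t -> sec_comp t m = colim_inj fam_functor i (res (X i) (dinj M t m)).
Proof.
move=> it; rewrite /sec_comp; case: pselect => [e|[]]; last by exists i.
case: (cid e) => j jt.
rewrite -[LHS]/(colim_inj fam_functor j (res (X j) (dinj M t m))).
have [k [ki kj kt _]] := X_filtered (conj it jt).
have mk := supported_dinj m kt.
by rewrite (colim_res ki mk) (colim_res kj mk).
Qed.

(** A left inverse sends the summand [M t] to its class in any piece containing [t]. *)
Lemma colim_tot_injective : injective colim_tot.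
Proof.
apply: (can_inj (g := dsum_desc sec_comp)); apply: colim_ind => [x y hx hy||i f].
- by rewrite !linearD hx hy.
- by rewrite !linear0.
elim/dsum_ind_gen: f => [|f g hf hg|[t p] m].
- by rewrite !linear0.
- by rewrite !linearD hf hg.
rewrite colim_tot_inj tot_dinj dsum_desc_dinj (sec_compE _ (set_mem p)).
by rewrite (res_dinj p).
Qed.

Lemma colim_tot_im f : supported (\bigcup_(i in [set: I]) X i) f ->
  exists y, colim_tot y = f.
Proof.
move=> fX; apply: (@dsum_ind_supp _ _ _ (im_submod colim_tot)) => [|g h|t].
- exact: sm0.
- exact: smD.
have [[i _ it]|nt] := pselect ((\bigcup_(i in [set: I]) X i) t).
  exists (colim_inj fam_functor i (res (X i) (dinj M t (dcoord f t)))).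
  by rewrite colim_tot_inj (resK (supported_dinj _ it)).
by exists 0; rewrite fX // !linear0.
Qed.

Lemma colim_tot_supported y : supported (\bigcup_(i in [set: I]) X i) (colim_tot y).
Proof.
elim/colim_ind: y => [x y hx hy||i f] t nt.
- by rewrite linearD dcoordD hx // hy // addr0.
- by rewrite linear0 dcoord0.
by rewrite colim_tot_inj tot_supported // => it; apply: nt; exists i.
Qed.

End Functor.

Section FamilyMap.
Variables (d : Order.disp_t) (I : porderType d).
Variables (X Y : I -> set T) (X_le : forall i j, (i <= j)%O -> X i `<=` X j).
Variables (Y_le : forall i j, (i <= j)%O -> Y i `<=` Y j).
Hypothesis XY : forall i, X i `<=` Y i.

Fact fam_incl_natural i j (ij : @Hom (poset_cat I) i j) f :
  (res (Y j) \o tot (A := X j) : {linear _ -> _}) (fmap (fam_functor X_le) ij f)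
  = fmap (fam_functor Y_le) ij ((res (Y i) \o tot (A := X i) : {linear _ -> _}) f).
Proof.
apply: tot_inj; apply: etrans (resK_sub _ (@XY j)) _.
by rewrite [LHS]tot_fmap [RHS]tot_fmap [RHS](resK_sub _ (@XY i)).
Qed.

Definition fam_incl : nattrans (fam_functor X_le) (fam_functor Y_le) :=
  @NatTrans R (poset_cat I) (fam_functor X_le) (fam_functor Y_le)
    (fun i => res (Y i) \o tot (A := X i)) fam_incl_natural.

Lemma tot_fam_incl i f : tot (fam_incl i f) = tot f.
Proof. exact: resK_sub. Qed.

Lemma fam_incl_inj i : injective (fam_incl i).
Proof. by move=> f g /(congr1 (tot (A := Y i))); rewrite !tot_fam_incl => /tot_inj. Qed.

End FamilyMap.

(** * Families in which every point has a least piece *)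

Section Principal.
Variables (d : Order.disp_t) (I : porderType d) (kappa : T -> option I).

(** The point [t] lies exactly in the pieces with index above [kappa t], and in none when [kappa t]
    is [None]. The functor of families is then a direct sum of functors that are constantly [M t] on
    a principal upper set. *)
Definition above i : set T := [set t | exists2 k, kappa t = Some k & (k <= i)%O].

Lemma above_le i j : (i <= j)%O -> above i `<=` above j.
Proof. by move=> ij t [k tk ki]; exists k => //; exact: le_trans ij. Qed.

Let Q := fam_functor above_le.

Let sec_comp i t : {linear M t -> bar Q i} :=
  match kappa t with
  | Some k => if pselect (k <= i)%O is left ki
    then @bgen R (poset_cat I) Q k i ki \o (res (above k) \o dinj M t : {linear M t -> Q k})
    else \0
  | None => \0
  end.

Let sec_compE i t k (ki : (k <= i)%O) (m : M t) : kappa t = Some k ->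
  sec_comp i t m = @bgen R (poset_cat I) Q k i ki (res (above k) (dinj M t m)).
Proof.
move=> tk; rewrite /sec_comp tk; case: pselect => // ki'.
by rewrite (Prop_irrelevance ki' ki).
Qed.

Let sec i : {linear Q i -> bar Q i} := dsum_desc (sec_comp i) \o tot (A := above i).

Let sec_dinj i t k (ki : (k <= i)%O) p (m : M t) : kappa t = Some k ->
  sec i (dinj (fun x : above i => M (sval x)) (exist _ t p) m)
  = @bgen R (poset_cat I) Q k i ki (res (above k) (dinj M t m)).
Proof.
by move=> tk; rewrite /sec lcompE tot_dinj dsum_desc_dinj; exact: sec_compE.
Qed.

Let sec_natural i j (ij : @Hom (poset_cat I) i j) f :
  sec j (fmap Q ij f) = fmap (bar Q) ij (sec i f).
Proof.
elim/dsum_ind_gen: f => [|f g hf hg|[t p] m].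
- by rewrite !linear0.
- by rewrite !linearD hf hg.
have [k tk ki] := set_mem p; have jt : above j t by exact: above_le ij _ (set_mem p).
rewrite (sec_dinj ki p m tk) [RHS]bar_fmap_gen.
have -> : fmap Q ij (dinj (fun x : above i => M (sval x)) (exist _ t p) m)
    = dinj (fun x : above j => M (sval x)) (exist _ t (mem_set jt)) m.
  by apply: tot_inj; rewrite tot_fmap; exact: tot_eq_dinj.
by rewrite (sec_dinj (le_trans ki ij) (mem_set jt) m tk).
Qed.

(** The splitting puts an element at [t] over [i] on the arrow [kappa t <= i]; this is natural
    because [kappa t] does not depend on [i]. *)
Lemma principal_bar_split : bar_split Q.
Proof.
exists (@NatTrans R (poset_cat I) Q (bar Q) sec sec_natural) => i f.
suff: bar_aug Q i (sec i f) = f by [].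
elim/dsum_ind_gen: f => [|f g hf hg|[t p] m].
- by rewrite !linear0.
- by rewrite !linearD hf hg.
have [k tk ki] := set_mem p.
rewrite (sec_dinj ki p m tk) bar_aug_gen.
apply: tot_inj; rewrite tot_fmap tot_dinj resK //.
by apply: supported_dinj; exists k.
Qed.

End Principal.

Section LocallyFiltered.
Variables (d : Order.disp_t) (I : porderType d).
Variables (X : I -> set T) (X_le : forall i j, (i <= j)%O -> X i `<=` X j).
Hypothesis X_filtered : forall i j x, (X i `&` X j) x ->
  exists k, [/\ (k <= i)%O, (k <= j)%O, X k x & X k `<=` X i `&` X j].

Let C := fam_functor X_le.

(** Going through the finite list, the filtered condition at [t] lowers the index each time an
    element with nonzero coordinate at [t] is met; [None] stands for no such element so far. *)
Let lower (s : seq {i : Ob (poset_cat I) & C i}) t : exists o : option I,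
  (forall k, o = Some k -> X k t) /\
  (forall z, List.In z s -> dcoord (tot (projT2 z : fam _)) t <> 0 ->
    exists2 k, o = Some k & (k <= projT1 z)%O).
Proof.
elim: s => [|[i f] s [o [oX os]]]; first by exists None.
have [f0|f0] := pselect (dcoord (tot f) t = 0).
  by exists o; split=> // z [<-|]; [move=> /(_ f0)|exact: os].
have it : X i t by apply: contrapT => nit; apply: f0; exact: tot_supported.
case: o oX os => [k|] oX os; last first.
  exists (Some i); split=> [_ [<-] //|z [<- _|zs z0]]; first by exists i.
  by have [k] := os z zs z0.
have [l [li lk lt _]] := X_filtered (conj it (oX k erefl)).
exists (Some l); split=> [_ [<-] //|z [<- _|zs z0]]; first by exists l.
by have [_ [<-] kz] := os z zs z0; exists l => //; exact: le_trans kz.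
Qed.

(** With [kappa] supplied by [lower], the principal pieces lie inside the pieces [X i] and contain
    the support of every element of the list. *)
Lemma fam_locally_split : locally_split C.
Proof.
move=> s; pose kappa t := sval (cid (lower s t)).
have kappaX t k : kappa t = Some k -> X k t.
  by rewrite /kappa; case: cid => o [oX _] /=; exact: oX.
have above_X i : above kappa i `<=` X i by move=> t [k /kappaX kt ki]; exact: X_le ki _ kt.
pose h := fam_incl (@above_le d I kappa) X_le above_X.
exists (fam_functor (@above_le d I kappa)), h; split.
- exact: principal_bar_split.
- by move=> i; exact: fam_incl_inj.
have hit_h z : List.In z s -> hit h (projT2 z).
  case: z => i f zs; exists (res (above kappa i) (tot f)).
  apply: tot_inj; rewrite tot_fam_incl resK // => t nt.
  apply: contrapT => t0; apply: nt; have [_ low] := svalP (cid (lower s t)).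
  exact: low zs t0.
have {}hit_h : forall l, (forall z, List.In z l -> List.In z s) -> hits h l.
  elim=> // z l IHl zl; split; first by apply: hit_h; apply: zl; left.
  by apply: IHl => y yl; apply: zl; right.
exact: hit_h.
Qed.

End LocallyFiltered.

End Families.

Arguments tot {R T M A}.
Arguments res {R T M} A.

(** * Chains on a covered graph *)

Section KernelLift.
Variables (R : pzRingType) (C : category) (X Y Z : functor R C).
Variables (p : nattrans X Y) (e : nattrans Z X).
Hypothesis pe : forall c x, p c (e c x) = 0.

Fact ker_lift_natural a b (f : Hom a b) x :
  (cores (S := ker_submod (p b)) (pe (c := b)) : {linear Z b -> ker_functor p b}) (fmap Z f x)
  = fmap (ker_functor p) f ((cores (S := ker_submod (p a)) (pe (c := a))) x).
Proof. by apply: val_inj; exact: nt_natural. Qed.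

Definition ker_lift : nattrans Z (ker_functor p) :=
  @NatTrans R C Z (ker_functor p) (fun c => cores (S := ker_submod (p c)) (pe (c := c)))
    ker_lift_natural.

End KernelLift.

Lemma bd_dinj (R : pzRingType) (G : graph) (F : graph_rep R G) (a : arr G) (m : F (src a)) :
  bd F (dinj (fun a => F (src a)) a m) = dinj F (tgt a) (rep_map F a m) - dinj F (src a) m.
Proof. by rewrite /bd dsum_desc_dinj. Qed.

Section GraphCover.
Variables (d : Order.disp_t) (I : porderType d) (R : pzRingType) (G : graph).
Variables (G_ : I -> subgraph G) (hG : graph_locally_filtered G_).
Variables (E : set (vert G)) (E_ : I -> set (vert G)).
Hypotheses (hEV : forall i, E_ i `<=` svert (G_ i)) (hE : locally_filtered E E_).
Variable F : graph_rep R G.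

Let M1 (a : arr G) : lmodType R := F (src a).
Let FH i := rep_restr F (G_ i).
Let EH i := set_restr (G_ i) (E_ i).
Arguments EH i : clear implicits.
Let le_arr := lf_le (glf_arr hG).
Let le_vert := lf_le (glf_vert hG).
Let le_E := lf_le hE.

Let C1 : functor R (poset_cat I) := fam_functor M1 le_arr.
Let C0 : functor R (poset_cat I) := fam_functor F le_vert.
Let CE : functor R (poset_cat I) := fam_functor F le_E.
Let Phi_ := Phi_functor hG hE F.
Let Phi0_ := Phi0_functor hG hE F.

Let tot1 i (f : C1 i) : chain1 F := tot f.
Let tot0 i (f : C0 i) : chain0 F := tot f.

Lemma tot_bd i (f : chain1 (FH i)) : tot0 (bd (FH i) f : C0 i) = bd F (tot1 (f : C1 i)).
Proof.
elim/dsum_ind_gen: f => [|f g hf hg|a m].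
- by rewrite /tot1 /tot0 !linear0.
- move: hf hg; rewrite /tot1 /tot0 => hf hg.
  by rewrite (linearD (bd (FH i))) linearD hf hg -(linearD (bd F)) -linearD.
rewrite /tot1 /tot0.
have -> : tot (dinj (fun a => FH i (src a)) a m : C1 i) = dinj M1 (sval a) m.
  exact: (tot_dinj (A := sarr (G_ i)) (M := M1)).
rewrite 2!bd_dinj linearB.
by congr (_ - _); exact: (tot_dinj (A := svert (G_ i)) (M := F)).
Qed.

Lemma tot_ext1 i j (ij : (i <= j)%O) (f : chain1 (FH i)) :
  tot1 (ext1 F (le_arr ij) f : C1 j) = tot1 (f : C1 i).
Proof.
elim/dsum_ind_gen: f => [|f g hf hg|a m].
- by rewrite /tot1 !linear0.
- move: hf hg; rewrite /tot1 => hf hg.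
  by rewrite (linearD (ext1 F (le_arr ij))) 2!linearD hf hg.
rewrite ext1_dinj /tot1.
exact: (etrans (tot_dinj (A := sarr (G_ j)) (M := M1) (x := incl (le_arr ij) a) m)
  (esym (tot_dinj (A := sarr (G_ i)) (M := M1) (x := a) m))).
Qed.

Lemma Phi_supported i (f : Phi_ i) : supported (E_ i) (bd F (tot1 (val f : C1 i))).
Proof.
move=> t nt; rewrite -tot_bd.
(* At a vertex of the [i]-th graph this is the condition defining [Phi]; at any other vertex the
   boundary has no component. *)
have [it|nit] := pselect (svert (G_ i) t); last exact: tot_supported.
have := sm_valS f (exist _ t (mem_set it)).
move=> /(_ nt); apply: etrans.
exact: (dcoord_tot (A := svert (G_ i)) (M := F) _ (exist _ t (mem_set it))).
Qed.

Fact graph_bd_natural i j (ij : @Hom (poset_cat I) i j) f :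
  (bd (FH j) : {linear C1 j -> C0 j}) (fmap C1 ij f)
  = fmap C0 ij ((bd (FH i) : {linear C1 i -> C0 i}) f).
Proof.
apply: tot_inj; rewrite tot_fmap.
apply: etrans (tot_bd _) (etrans _ (esym (tot_bd _))).
by congr (bd F _); exact: tot_fmap.
Qed.

Definition graph_bd : nattrans C1 C0 :=
  @NatTrans R (poset_cat I) C1 C0 (fun i => bd (FH i)) graph_bd_natural.

Lemma tot_graph_bd i (f : C1 i) : tot (graph_bd i f) = bd F (tot f).
Proof. exact: tot_bd. Qed.

Definition aug_comp i : {linear C0 i -> Phi0_ i} :=
  dsum_desc (fun v : svert (G_ i) => Phi0_inj (EH i) (FH i) (Some v)).

Lemma aug_comp_dinj i (v : svert (G_ i)) (m : F (sval v)) :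
  aug_comp i (dinj (fun v : svert (G_ i) => F (sval v)) v m)
  = Phi0_inj (EH i) (FH i) (Some v) m.
Proof. exact: dsum_desc_dinj. Qed.

Fact aug_natural i j (ij : @Hom (poset_cat I) i j) f :
  aug_comp j (fmap C0 ij f) = fmap Phi0_ ij (aug_comp i f).
Proof.
elim/dsum_ind_gen: f => [|f g hf hg|[t p] m].
- by rewrite !linear0.
- by rewrite !linearD hf hg.
have jt : svert (G_ j) t by exact: le_vert ij _ (set_mem p).
have -> : fmap C0 ij (dinj (fun v : svert (G_ i) => F (sval v)) (exist _ t p) m)
   = dinj (fun v : svert (G_ j) => F (sval v)) (exist _ t (mem_set jt)) m.
  by apply: tot_inj; rewrite tot_fmap; exact: tot_eq_dinj.
rewrite aug_comp_dinj [X in fmap Phi0_ ij X]aug_comp_dinj.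
rewrite (Phi0_map_inj (le_arr ij) (le_vert ij) (le_E ij)
  (v := (Some (exist _ t p) : vert (cone_graph (EH i))))).
exact: Phi0_inj_irr.
Qed.

Definition graph_aug : nattrans C0 Phi0_ :=
  @NatTrans R (poset_cat I) C0 Phi0_ aug_comp aug_natural.

Lemma graph_aug_surj i : surj (graph_aug i).
Proof.
elim/colim_ind => [x y||[v|] m].
- exact: (@smD _ _ (im_submod (graph_aug i))).
- exact: (sm0 (im_submod (graph_aug i))).
- by exists (dinj (fun v : svert (G_ i) => F (sval v)) v m); exact: aug_comp_dinj.
(* The cone point contributes nothing, its module being zero. *)
- by exists 0; rewrite (zero_module0 m) !linear0.
Qed.

Let inclE : nattrans CE C0 := fam_incl F le_E le_vert hEV.
Let Y := prod_functor C1 CE.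
(** These are the relations presenting [Phi0]: an arrow of the graph identifies [x] with its image,
    and an arrow to the cone point kills the module at a vertex of [E_ i]. *)
Let dY : nattrans Y C0 := prod_copair graph_bd inclE.

Let dYE i (y : Y i) : dY i y = graph_bd i y.1 + inclE i y.2.
Proof. by []. Qed.

Lemma graph_aug_exact i : exact_at (dY i) (graph_aug i).
Proof.
pose B := im_submod (dY i).
(* The cokernel of [dY i] receives a cocone, zero at the cone point. The induced map from [Phi0]
   composed with the augmentation is the projection, so the kernel of the augmentation is no larger
   than the image. *)
pose u v : {linear cone_rep (EH i) (FH i) v -> quotm B} :=
  match v return {linear cone_rep (EH i) (FH i) v -> quotm B} with
  | Some v => qpi B \o dinj (fun v : svert (G_ i) => F (sval v)) v
  | None => \0
  end.
have u_arr (a : arr (cone_graph (EH i))) x :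
    u (tgt a) (rep_map (cone_rep (EH i) (FH i)) a x) = u (src a) x.
  case: a x => [a|e] x.
    apply/qpi_eq; exists (dinj (fun a => FH i (src a)) a x, 0).
    rewrite dYE linear0 addr0; exact: (@bd_dinj R _ (FH i) a x).
  apply: esym; apply/(qpi_eq0 B).
  case: e x => -[t p] e x.
  pose te : E_ i := exist _ t (mem_set (set_mem e : E_ i t)).
  exists (0, dinj (fun v : E_ i => F (sval v)) te x).
  rewrite dYE linear0 add0r; apply: tot_inj; rewrite tot_fam_incl.
  exact: tot_eq_dinj.
have u_cocone v w (q : gpath v w) x : u w (path_map (cone_rep (EH i) (FH i)) q x) = u v x.
  elim: q => // a q <-; exact: u_arr.
pose c := @colim_desc R _ (path_functor (cone_rep (EH i) (FH i))) _ u u_cocone.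
have cE : forall f, c (graph_aug i f) = qpi B f.
  elim/dsum_ind_gen => [|f g hf hg|v m].
  - by rewrite !linear0.
  - by rewrite !linearD hf hg.
  rewrite aug_comp_dinj; exact: colim_desc_inj.
move=> f; split=> [f0|[y <-]].
  by apply/(qpi_eq0 B); rewrite -cE f0 linear0.
rewrite dYE linearD.
have -> : graph_aug i (graph_bd i y.1) = 0.
  elim/dsum_ind_gen: (y.1 : chain1 (FH i)) => [|k g hk hg|a m].
  - by rewrite !linear0.
  - by rewrite !linearD hk hg addr0.
  rewrite [X in graph_aug i X]bd_dinj linearB 2!aug_comp_dinj.
  apply/eqP; rewrite subr_eq0; apply/eqP.
  exact: (@Phi0_arr R _ (EH i) (FH i) (inl a)).
rewrite add0r; elim/dsum_ind_gen: (y.2) => [|k g hk hg|[t p] m].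
- by rewrite !linear0.
- by rewrite !linearD hk hg addr0.
have it := hEV (set_mem p).
have -> : inclE i (dinj (fun v : E_ i => F (sval v)) (exist _ t p) m)
    = dinj (fun v : svert (G_ i) => F (sval v)) (exist _ t (mem_set it)) m.
  by apply: tot_inj; rewrite tot_fam_incl; exact: tot_eq_dinj.
rewrite aug_comp_dinj.
have te : (exist _ t (mem_set it) : vert (graph_of (G_ i))) \in EH i.
  by apply/mem_set; exact: (set_mem p).
pose a : arr (cone_graph (EH i)) := inr (exist (fun v => v \in EH i) _ te).
have h := @Phi0_arr R _ (EH i) (FH i) a m.
by rewrite -[LHS]h linear0.
Qed.

Let C0_acyclic : acyclic1 C0.
Proof.
apply: locally_split_acyclic1; exact: fam_locally_split (lf_filtered (glf_vert hG)).
Qed.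

Let SC0_acyclic : acyclic1 (bsyz C0).
Proof.
apply: locally_split_acyclic1; apply: locally_split_bsyz.
exact: fam_locally_split (lf_filtered (glf_vert hG)).
Qed.

Let Y_acyclic : acyclic1 Y.
Proof.
apply: prod_acyclic1; apply: locally_split_acyclic1; apply: fam_locally_split.
  exact: lf_filtered (glf_arr hG).
exact: lf_filtered hE.
Qed.

Let e_graph : nattrans Y (ker_functor graph_aug) :=
  ker_lift (p := graph_aug) (e := dY) (fun i y => exact_comp0 y (@graph_aug_exact i)).

Fact Phi_incl_natural i j (ij : @Hom (poset_cat I) i j) (f : Phi_ i) :
  (val (fmap Phi_ ij f) : C1 j) = fmap C1 ij (val f : C1 i).
Proof.
apply: tot_inj.
exact: (etrans (tot_ext1 ij (val f)) (esym (tot_fmap ij (val f : C1 i)))).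
Qed.

Definition Phi_incl : nattrans Phi_ C1 :=
  @NatTrans R (poset_cat I) Phi_ C1 (fun i => (val : {linear Phi_ i -> C1 i}))
    Phi_incl_natural.

Definition bdE_comp i : {linear Phi_ i -> CE i} :=
  res (E_ i) \o (bd F \o (tot \o Phi_incl i : {linear Phi_ i -> chain1 F})
    : {linear Phi_ i -> chain0 F}).

Lemma tot_bdE i (f : Phi_ i) : tot (bdE_comp i f) = bd F (tot (Phi_incl i f)).
Proof. exact: (resK (Phi_supported f)). Qed.

Fact bdE_natural i j (ij : @Hom (poset_cat I) i j) f :
  bdE_comp j (fmap Phi_ ij f) = fmap CE ij (bdE_comp i f).
Proof.
apply: tot_inj; apply: (etrans (tot_bdE (fmap Phi_ ij f))).
apply: (etrans _ (esym (tot_fmap ij (bdE_comp i f)))).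
apply: (etrans _ (esym (tot_bdE f))).
have h := etrans (congr1 tot (Phi_incl_natural ij f)) (tot_fmap ij (val f : C1 i)).
exact: (congr1 (bd F) h).
Qed.

Let Phi_bd : nattrans Phi_ CE :=
  @NatTrans R (poset_cat I) Phi_ CE bdE_comp bdE_natural.

Fact Phi_bdN_natural i j (ij : @Hom (poset_cat I) i j) f :
  (- (Phi_bd j (fmap Phi_ ij f))) = fmap CE ij (- Phi_bd i f).
Proof. by rewrite nt_natural linearN. Qed.

(** The sign makes the pair of a chain and this map a zero of [dY], which adds its two
    components. *)
Let Phi_bdN : nattrans Phi_ CE :=
  @NatTrans R (poset_cat I) Phi_ CE (fun i => (-%R \o Phi_bd i : {linear Phi_ i -> CE i}))
    Phi_bdN_natural.

Let j_graph : nattrans Phi_ Y := prod_pair Phi_incl Phi_bdN.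

(** A pair [(f, g)] in the kernel of [dY] is determined by [f], since [g] is [- bd f]; such a [g]
    over [E_ i] exists exactly when the boundary of [f] vanishes off [E_ i]. *)
Lemma graph_short_exact : short_exact j_graph e_graph.
Proof.
split=> i.
- by move=> f g [fg _]; exact: val_inj.
- move=> y; split=> [y0|[f <-]]; last first.
    apply: val_inj; apply: tot_inj.
    rewrite [X in tot X](dYE (j_graph i f)) linearD tot_graph_bd tot_fam_incl.
    by rewrite linearN tot_bdE subrr linear0.
  have dy0 : dY i y = 0 := congr1 val y0.
  have {}dy0 : bd F (tot y.1) = - tot y.2.
    apply/eqP; rewrite -addr_eq0 -tot_graph_bd.
    by rewrite -(tot_fam_incl (X_le := le_E) le_vert hEV) -linearD -dYE dy0 linear0.
  have fP : Phi_submod (EH i) (FH i) y.1.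
    move=> v nv; rewrite -(dcoord_tot (A := svert (G_ i)) (M := F)).
    rewrite [X in dcoord X _](tot_bd (y.1 : chain1 (FH i))) [X in dcoord X _]dy0.
    by rewrite dcoordN tot_supported // oppr0.
  exists (sm_mk fP).
  have h1 : Phi_incl i (sm_mk fP) = y.1 by [].
  have h2 : - bdE_comp i (sm_mk fP) = y.2.
    by apply: tot_inj; rewrite linearN tot_bdE h1 dy0 opprK.
  exact: (etrans (congr1 (pair y.1) h2) (esym (surjective_pairing y))).
- move=> x; have [y yx] := (graph_aug_exact (sm_val x)).1 (sm_valS x).
  by exists y; apply: val_inj.
Qed.

Lemma graph_colim2 : exists f : {linear colimn 2 Phi0_ -> colim Phi_},
  injective f /\ exact_at f (colim_map j_graph).
Proof.
exact: colim2_acyclic graph_aug_surj graph_short_exact C0_acyclic SC0_acyclic Y_acyclic.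
Qed.

Lemma graph_colim1 : exists u : {linear colimn 1 Phi0_ -> colim (ker_functor graph_aug)},
  injective u /\ exact_at u (colim_map (ker_incl graph_aug)).
Proof. exact: colim1_acyclic graph_aug_surj C0_acyclic. Qed.

(** * The colimits as chain modules of the whole graph *)

Let tot_arr : {linear colim Y -> chain1 F} :=
  colim_tot M1 le_arr \o colim_map (prod_pr1 C1 CE).
Let tot_E : {linear colim Y -> chain0 F} :=
  colim_tot F le_E \o colim_map (prod_pr2 C1 CE).
Let tot_arrE y : tot_arr y = colim_tot M1 le_arr (colim_map (prod_pr1 C1 CE) y).
Proof. by []. Qed.
Let tot_EE y : tot_E y = colim_tot F le_E (colim_map (prod_pr2 C1 CE) y).
Proof. by []. Qed.
Let tot_vert : {linear colim C0 -> chain0 F} := colim_tot F le_vert.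

Let tot_vert_inj : injective tot_vert.
Proof. exact: colim_tot_injective (lf_filtered (glf_vert hG)). Qed.

Let tot_Y_inj y : tot_arr y = 0 -> tot_E y = 0 -> y = 0.
Proof.
move=> y1 y2; rewrite (colim_prod_decomp y).
have -> : colim_map (prod_pr1 C1 CE) y = 0.
  exact: (linear_inj0 (colim_tot_injective (lf_filtered (glf_arr hG))) y1).
have -> : colim_map (prod_pr2 C1 CE) y = 0.
  exact: (linear_inj0 (colim_tot_injective (lf_filtered hE)) y2).
by rewrite (linear0 (colim_map (prod_in1 C1 CE))) (linear0 (colim_map (prod_in2 C1 CE))) addr0.
Qed.

Let tot_Y_im f g : supported E g -> exists y, tot_arr y = f /\ tot_E y = g.
Proof.
move=> gE.
have [|y1 y1f] := @colim_tot_im _ _ M1 _ _ _ le_arr f.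
  by rewrite -(lf_cover (glf_arr hG)) => t [].
have [|y2 y2g] := @colim_tot_im _ _ F _ _ _ le_E g; first by rewrite -(lf_cover hE).
have pr11 : colim_map (prod_pr1 C1 CE) (colim_map (prod_in1 C1 CE) y1) = y1.
  by rewrite (colim_map_comp (k := id_nt C1)) ?colim_map_id // => c x; exact: addr0.
have pr12 : colim_map (prod_pr1 C1 CE) (colim_map (prod_in2 C1 CE) y2) = 0.
  by rewrite (colim_map_comp (k := zero_nt CE C1)) ?colim_map0 // => c x; exact: addr0.
have pr21 : colim_map (prod_pr2 C1 CE) (colim_map (prod_in1 C1 CE) y1) = 0.
  by rewrite (colim_map_comp (k := zero_nt C1 CE)) ?colim_map0 // => c x; exact: add0r.
have pr22 : colim_map (prod_pr2 C1 CE) (colim_map (prod_in2 C1 CE) y2) = y2.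
  by rewrite (colim_map_comp (k := id_nt CE)) ?colim_map_id // => c x; exact: add0r.
exists (colim_map (prod_in1 C1 CE) y1 + colim_map (prod_in2 C1 CE) y2).
rewrite tot_arrE tot_EE.
by rewrite (linearD (colim_map (prod_pr1 C1 CE))) (linearD (colim_map (prod_pr2 C1 CE)))
  pr11 pr12 pr21 pr22 addr0 add0r.
Qed.

Let tot_E_supported y : supported E (tot_E y).
Proof. by rewrite [E in supported E _](lf_cover hE); exact: colim_tot_supported. Qed.

(** In these coordinates the map [colim Y -> colim C0] is [(f, g) |-> bd f + g], so its kernel is
    [Phi E F], with [f] in it corresponding to [(f, - bd f)]. *)
Let tot_Y_bd y :
  tot_vert (colim_map (ker_incl graph_aug) (colim_map e_graph y))
  = bd F (tot_arr y) + tot_E y.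
Proof.
rewrite (colim_map_comp (k := dY)) //.
elim/colim_ind: y => [x y hx hy||i y].
- by rewrite !linearD hx hy addrACA.
- by rewrite !linear0 addr0.
rewrite tot_arrE tot_EE /tot_vert 3!colim_map_inj 3!colim_tot_inj.
rewrite dYE linearD tot_graph_bd tot_fam_incl.
exact: (congr2 (fun (a : C1 i) (b : CE i) => bd F (tot a) + tot b)
  (esym (prod_fstE y)) (esym (prod_sndE y))).
Qed.

Let tot_Phi_bd x : bd F (tot_arr (colim_map j_graph x)) = - tot_E (colim_map j_graph x).
Proof.
apply/eqP; rewrite -addr_eq0 -tot_Y_bd.
by rewrite (exact_comp0 _ (colim_short_exact graph_short_exact)) !linear0.
Qed.

(** With [B] the kernel of [graph_aug], the sequence [colim Phi_ -> colim Y -> colim B -> 0] is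
    exact. Restricting it to the kernels of the maps to [colim C0] gives [colim Phi_ -> Phi E F ->
    ker (colim B -> colim C0) -> 0], whose last term is [colimn 1] of [Phi0_]; the kernel on the
    left is [colimn 2]. *)
Lemma graph_sequence :
  exists (f : {linear colimn 2 Phi0_ -> colim Phi_})
         (g : {linear colim Phi_ -> Phi E F})
         (h : {linear Phi E F -> colimn 1 Phi0_}),
    [/\ injective f, exact_at f g, exact_at g h & surj h].
Proof.
have [f [fI fj]] := graph_colim2; have [u [uI uex]] := graph_colim1.
have ej := colim_short_exact graph_short_exact.
have eS := colim_map_surj (se_surj graph_short_exact).
have gP x : Phi_submod E F ((tot_arr \o colim_map j_graph : {linear _ -> _}) x).
  by move=> v nv; rewrite lcompE tot_Phi_bd dcoordN tot_E_supported // oppr0.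
pose g := cores gP.
have valg x : val (g x) = tot_arr (colim_map j_graph x) by [].
(* The third map lifts [z] to the class [(z, - bd z)] of [colim Y], pushes it to [colim B], and
   reads the result through the injection [u]. *)
pose r (z : Phi E F) w := exists y,
  [/\ tot_arr y = val z, tot_E y = - bd F (val z) & u w = colim_map e_graph y].
have [|z|w [y [y1 y2 uw]]|h hP] := @linear_of_rel R (Phi E F) (colimn 1 Phi0_) r.
- move=> a z z' w w' [y [y1 y2 uw]] [y' [y1' y2' uw']]; exists (a *: y + y').
  split; [by rewrite !linearP y1 y1'| |by rewrite !linearP uw uw'].
  rewrite linearP y2 y2'.
  have -> : val (a *: z + z') = a *: val z + val z' by [].
  by rewrite (linearP (bd F)) opprD scalerN.
- have [|y [y1 y2]] := @tot_Y_im (val z) (- bd F (val z)).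
    by apply: supportedN; exact: (sm_valS z).
  have /uex[w wy] : colim_map (ker_incl graph_aug) (colim_map e_graph y) = 0.
    by apply: tot_vert_inj; rewrite tot_Y_bd y1 y2 subrr linear0.
  by exists w, y.
- apply: (linear_inj0 uI); rewrite uw (_ : y = 0) ?linear0 //.
  by apply: tot_Y_inj; rewrite ?y1 ?y2 !linear0 ?oppr0.
exists f, g, h; split; first exact: fI.
- move=> x; rewrite -fj; split=> [gx0|jx0]; last first.
    by apply: val_inj; rewrite valg jx0 !linear0.
  have x1 : tot_arr (colim_map j_graph x) = 0 by rewrite -valg gx0.
  (* On the image of [colim Phi_] the second coordinate is minus the boundary of the first, so it
     vanishes along with it. *)
  apply: (tot_Y_inj x1); apply/eqP.
  by rewrite -oppr_eq0 -tot_Phi_bd x1 linear0.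
- move=> z; split=> [/hP[y [y1 y2]]|[x <-]]; last first.
    apply/hP; exists (colim_map j_graph x); split; first by [].
      by rewrite valg tot_Phi_bd opprK.
    by rewrite linear0 (exact_comp0 _ ej).
  rewrite linear0 => /esym/ej[x xy]; exists x.
  by apply: val_inj; rewrite valg xy.
(* Surjectivity: lift [u w] to [y] in [colim Y]. As [u w] dies in [colim C0], so does [y], and its
   first coordinate is then an element of [Phi E F]. *)
- move=> w; have [y yw] := eS (u w).
  have y0 : bd F (tot_arr y) + tot_E y = 0.
    by rewrite -tot_Y_bd yw (exact_comp0 _ uex) linear0.
  have zP : Phi_submod E F (tot_arr y).
    move=> v nv; have -> : bd F (tot_arr y) = - tot_E y by apply/eqP; rewrite -addr_eq0 y0.
    by rewrite dcoordN tot_E_supported // oppr0.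
  exists (sm_mk zP); apply/hP; exists y; split; [by []| |by []].
  by apply/eqP; rewrite -addr_eq0 addrC; apply/eqP.
Qed.

End GraphCover.

Theorem theorem4p1 (R : pzRingType) (d : Order.disp_t) (I : porderType d)
    (G : graph) (G_ : I -> subgraph G) (hG : graph_locally_filtered G_)
    (E : set (vert G)) (E_ : I -> set (vert G))
    (hEV : forall i, E_ i `<=` svert (G_ i)) (hE : locally_filtered E E_)
    (F : graph_rep R G) :
  exists (f : {linear colimn 2 (Phi0_functor hG hE F) -> colim (Phi_functor hG hE F)})
         (g : {linear colim (Phi_functor hG hE F) -> Phi E F})
         (h : {linear Phi E F -> colimn 1 (Phi0_functor hG hE F)}),
    [/\ injective f, exact_at f g, exact_at g h & surj h].
Proof. exact: graph_sequence. Qed.
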